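(* Let $f$ be a continuous convex function on an interval $J$. Let $A_i,B_i,C_i,D_i\in\sigma(J)$ $(i=1,\ldots,n)$ be such that $A_i+D_i=B_i+C_i$ and $A_i\leq m\leq B_i\leq M\leq D_i$, $m\leq C_i\leq M$ $(i=1,\ldots,n)$ for two real numbers $m<M$. Let $\Phi_1,\ldots,\Phi_n$ be positive linear mappings on $\mathbb{B}(\mathscr{H})$ with $\sum_{i=1}^{n}\Phi_i(I)=I$. Put $\delta_f=f(m)+f(M)-2f\left(\frac{m+M}{2}\right)$. Then (1) $$\begin{aligned} f\left(\sum_{i=1}^{n}\Phi_i(B_i)\right)+f\left(\sum_{i=1}^{n}\Phi_i(C_i)\right)&\leq\sum_{i=1}^{n}\Phi_i(f(A_i))+\sum_{i=1}^{n}\Phi_i(f(D_i))-\delta_f\widetilde{X}_1\\&\leq\sum_{i=1}^{n}\Phi_i(f(A_i))+\sum_{i=1}^{n}\Phi_i(f(D_i));\end{aligned}$$ (2) $$\begin{aligned}\sum_{i=1}^{n}\Phi_i(f(B_i))+\sum_{i=1}^{n}\Phi_i(f(C_i))&\leq f\left(\sum_{i=1}^{n}\Phi_i(A_i)\right)+f\left(\sum_{i=1}^{n}\Phi_i(D_i)\right)-\delta_f\widetilde{X}_2\\&\leq f\left(\sum_{i=1}^{n}\Phi_i(A_i)\right)+f\left(\sum_{i=1}^{n}\Phi_i(D_i)\right);\end{aligned}$$ (3) $$\begin{aligned}\sum_{i=1}^{n}\Phi_i(f(B_i))+f\left(\sum_{i=1}^{n}\Phi_i(C_i)\right)&\leq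 f\left(\sum_{i=1}^{n}\Phi_i(D_i)\right)+\sum_{i=1}^{n}\Phi_i(f(A_i))-\delta_f\widetilde{X}_3\\&\leq f\left(\sum_{i=1}^{n}\Phi_i(D_i)\right)+\sum_{i=1}^{n}\Phi_i(f(A_i));\end{aligned}$$ where $$\widetilde{X}_1=1-\frac{1}{M-m}\left[\left|\sum_{i=1}^{n}\Phi_i(B_i)-\frac{m+M}{2}\right|+\left|\sum_{i=1}^{n}\Phi_i(C_i)-\frac{m+M}{2}\right|\right],$$ $$\widetilde{X}_2=1-\frac{1}{M-m}\left[\sum_{i=1}^{n}\Phi_i\left(\left|B_i-\frac{m+M}{2}\right|\right)+\sum_{i=1}^{n}\Phi_i\left(\left|C_i-\frac{m+M}{2}\right|\right)\right],$$ $$\widetilde{X}_3=1-\frac{1}{M-m}\left[\sum_{i=1}^{n}\Phi_i\left(\left|B_i-\frac{m+M}{2}\right|\right)+\left|\sum_{i=1}^{n}\Phi_i(C_i)-\frac{m+M}{2}\right|\right].$$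
   Context: $\mathscr{H}$ is a complex Hilbert space, $\mathbb{B}(\mathscr{H})$ the $C^*$-algebra of bounded linear operators on it, $I$ the identity. $\sigma(J)$ denotes the set of all self-adjoint operators on $\mathscr{H}$ with spectra contained in $J$. The order $\leq$ on self-adjoint operators is the usual one ($S\leq T$ iff $T-S$ is positive semidefinite); a scalar in an operator inequality or expression stands for that scalar times $I$. $f(T)$ is defined by continuous functional calculus and $|T|=(T^2)^{1/2}$. A linear map on $\mathbb{B}(\mathscr{H})$ is positive if it maps positive operators to positive operators. *)

(* Defs.v *)
From HB Require Import structures.
From mathcomp Require Import all_boot all_order all_algebra.
From mathcomp Require Import all_classical all_reals all_analysis.
From mathcomp Require Import complex.

Set Implicit Arguments.
Unset Strict Implicit.
Unset Printing Implicit Defensive.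

Import Order.TTheory GRing.Theory Num.Theory.
Import numFieldNormedType.Exports.

Local Open Scope classical_set_scope.
Local Open Scope ring_scope.
Local Open Scope complex_scope.

(* [{dot H for Num.conj}] is linear in its first argument and conjugate-linear
   in the second one. Norms of a complex normed module live in [R[i]], where
   [0 <= z] means that z is a nonnegative real. *)
HB.mixin Record NormedModule_isHilbert (R : realType) H
    of CompleteNormedModule R[i] H := {
  hdot : {dot H for Num.conj};
  normr_hdot : forall x : H, `|x| ^+ 2 = hdot x x
}.

#[short(type="hilbertType")]
HB.structure Definition Hilbert (R : realType) :=
  {H of NormedModule_isHilbert R H & CompleteNormedModule R[i] H}.

Section BoundedOperators.
Context {R : realType} (H : hilbertType R).

Definition bounded_linear : pred (H -> H) :=
  fun T => `[< linear T /\ exists M : R, forall x, `|T x| <= M%:C * `|x| >].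

Record bop := Bop {
  bop_fun :> H -> H;
  bop_funP : bounded_linear bop_fun
}.

HB.instance Definition _ := [isSub for bop_fun].
HB.instance Definition _ := [Choice of bop by <:].

Fact bounded_linear_submod : submod_closed bounded_linear.
Proof.
split=> [|a S T /asboolP[lS [M bS]] /asboolP[lT [N bT]]]; apply/asboolP.
  split=> [b x y|]; first by rewrite scaler0 addr0.
  by exists 0 => x; rewrite normr0 mul0r.
split=> [b x y|].
  have -> z : (a *: S + T) z = a *: S z + T z by [].
  by rewrite lS lT !scalerDr !scalerA mulrC addrACA.
exists (complex.Re `|a| * M + N) => x.
have -> : (a *: S + T) x = a *: S x + T x by [].
rewrite (le_trans (ler_normD _ _))// normrZ rmorphD rmorphM/= mulrDl lerD//.
have -> : (complex.Re `|a|)%:C = `|a| by rewrite RRe_real ?normr_real.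
by rewrite -mulrA ler_wpM2l.
Qed.

HB.instance Definition _ := GRing.isSubmodClosed.Build R[i] (H -> H)
  bounded_linear (GRing.submod_closed_semi bounded_linear_submod).
HB.instance Definition _ := [SubChoice_isSubLmodule of bop by <:].

Fact bounded_linear_id : bounded_linear (fun x => x).
Proof. by apply/asboolP; split=> //; exists 1 => x; rewrite mul1r. Qed.

Fact bounded_linear_comp (S T : bop) : bounded_linear (S \o T).
Proof.
have [lS [M bS]] := asboolP _ (bop_funP S).
have [lT [N bT]] := asboolP _ (bop_funP T).
apply/asboolP; split=> [a x y /=|]; first by rewrite lT lS.
exists (`|M| * N) => x /=; rewrite (le_trans (bS _))//.
have -> : (`|M| * N)%:C * `|x| = `|M|%:C * (N%:C * `|x|).
  by rewrite rmorphM mulrA.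
rewrite (@le_trans _ _ (`|M|%:C * `|T x|))//.
  by rewrite ler_wpM2r// lecR ler_norm.
by rewrite ler_wpM2l// ler0c.
Qed.

Definition bop_one : bop := Bop bounded_linear_id.
Definition bop_mul (S T : bop) : bop := Bop (bounded_linear_comp S T).

Fact bop_mulA : associative bop_mul. Proof. by move=> S T U; apply/val_inj. Qed.
Fact bop_1mul : left_id bop_one bop_mul. Proof. by move=> S; apply/val_inj. Qed.
Fact bop_mul1 : right_id bop_one bop_mul. Proof. by move=> S; apply/val_inj. Qed.
Fact bop_mulDl : left_distributive bop_mul +%R.
Proof. by move=> S T U; apply/val_inj. Qed.
Fact bop_mulDr : right_distributive bop_mul +%R.
Proof.
move=> [S PS] T U; apply/val_inj/funext => x /=.
have [lS _] := asboolP _ PS.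
by have := lS 1 (T x) (U x); rewrite !scale1r.
Qed.

(* Only a [pzRingType]: the zero Hilbert space, on which 1 = 0, is allowed. *)
HB.instance Definition _ := GRing.Zmodule_isPzRing.Build bop
  bop_mulA bop_1mul bop_mul1 bop_mulDl bop_mulDr.

End BoundedOperators.

Section OperatorTheory.
Context {R : realType} {H : hilbertType R}.
Implicit Types S T : bop H.

(* The real scalar c, seen as the operator c I. *)
Definition scal_op (c : R) : bop H := c%:C *: (1 : bop H).

Definition opnorm T : R :=
  inf [set M : R | 0 <= M /\ forall x, `|T x| <= M%:C * `|x|].

Definition self_adjoint T : Prop := forall x y, hdot (T x) y = hdot x (T y).

(* In a complex Hilbert space nonnegativity of hdot (T x) x implies
   that T is self-adjoint. *)
Definition positive_op T : Prop := forall x, 0 <= hdot (T x) x.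

Definition le_op S T : Prop := positive_op (T - S).

Definition spectrum T : set R[i] :=
  [set l | let U := T - l *: (1 : bop H) in
           ~ exists S : bop H, S * U = 1 /\ U * S = 1].

Definition sa_spec_in (J : set R) : set (bop H) :=
  [set T | self_adjoint T /\ spectrum T `<=` [set t%:C | t in J]].

Definition horner_op (p : {poly R}) T : bop H :=
  \sum_(i < size p) (p`_i)%:C *: T ^+ i.

(* Continuous functional calculus of a self-adjoint operator T: S = f(T) when S
   is the norm limit of p(T) for real polynomials p converging to f uniformly on
   the spectrum of T (the extension by continuity of p |-> p(T) from polynomials
   to C(sigma(T))). Only the values of f on the spectrum matter. *)
Definition is_cfc (f : R -> R) T S : Prop :=
  forall e : R, 0 < e -> exists p : {poly R},
    (forall t : R, spectrum T t%:C -> `|p.[t] - f t| <= e) /\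
    opnorm (horner_op p T - S) <= e.

(* For T self-adjoint and f continuous on its spectrum there is exactly one S
   such that [is_cfc f T S]; the value 0 is junk outside of that case. *)
Definition cfc (f : R -> R) T : bop H := xget 0 [set S | is_cfc f T S].

Definition abs_op T : bop H := cfc Num.sqrt (T ^+ 2).

Definition positive_map (Phi : bop H -> bop H) : Prop :=
  forall T, positive_op T -> positive_op (Phi T).

End OperatorTheory.

Arguments scal_op {R H} c.

Notation "S <=op T" := (le_op S T) (at level 70, no associativity) : ring_scope.

(* Main.v *)
Require Import Defs.
From mathcomp Require Import all_boot all_order all_algebra.
From mathcomp Require Import all_classical all_reals all_analysis.
From mathcomp Require Import complex ring lra.
Import Order.TTheory GRing.Theory Num.Theory.
Import numFieldNormedType.Exports.
Local Open Scope classical_set_scope.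
Local Open Scope ring_scope.
Local Open Scope complex_scope.
Set Implicit Arguments.
Unset Strict Implicit.
Unset Printing Implicit Defensive.

(** Write l for the secant of f through (m, f m) and (M, f M), mid for the
midpoint of [m, M] and delta for the gap f m + f M - 2 f mid, which is
nonnegative by convexity. Two scalar inequalities carry the result. On [m, M],
convexity of f on the two halves gives the refined upper bound
f t <= l t - delta / 2 + delta / (M - m) * |t - mid|
([convex_le_secant]); on the part of J outside ]m, M[, it gives l t <= f t
([secant_le_convex]).

The functional calculus turns them into operator inequalities. The upper bound
holds for every operator between m and M: for the B_i and the C_i, hence after
averaging by the Phi_i, and just as well for the averages of the B_i and of the
C_i. The lower bound holds for operators with spectrum on one side of ]m, M[:
for the A_i and the D_i, and for their averages, which stay on that side
because a positive unital family preserves scalar bounds. In every combination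
the affine parts cancel because A_i + D_i = B_i + C_i, and what is left of the
upper bounds is exactly the correction delta X. This is
[secant_combine], from which the three double inequalities are read off
by choosing for each of A, B, C, D whether f is applied before or after
averaging. The correction is nonnegative since |T - mid| <= (M - m) / 2 for
T between m and M.

What the calculus has to provide is existence (a continuous f has an f(T)) and
monotonicity (f <= g on the spectrum implies f(T) <= g(T)). Both come from one
fact about real polynomials: if P >= 0 on the spectrum of a self-adjoint T then
P(T) >= 0 ([horner_op_ge0]). Indeed the greatest lower bound a of the
numerical range of P(T) lies in the spectrum of P(T) ([min_spectrum]);
factoring P - a over the complex numbers shows that one of its roots is in the
spectrum of T, hence is real ([sa_spectrum_real]), so a is a value of P
there. Therefore P |-> P(T) is contractive for the sup norm on the spectrum
([horner_op_bounded]), and f(T) is obtained from approximating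
polynomials ([weierstrass]) by completeness ([bop_complete],
[is_cfc_cfc]). *)

(** * Polynomial approximation on a segment *)

Section Bernstein.
Context {R : realType}.
Implicit Types (f : R -> R) (h : nat -> R).

(** The Bernstein polynomial of the sample values h 0, ..., h n. The recursion on
the first of n independent coin flips with success probability 'X avoids
binomial coefficients: the polynomial is the expectation of h at the number of
successes. *)
Fixpoint bernstein n h : {poly R} :=
  if n is n'.+1 then
    'X * bernstein n' (h \o succn) + (1 - 'X) * bernstein n' h
  else (h 0)%:P.

Lemma bernsteinS n h x : (bernstein n.+1 h).[x] =
  x * (bernstein n (h \o succn)).[x] + (1 - x) * (bernstein n h).[x].
Proof. by rewrite /= !hornerE. Qed.

(** Linearity of the expectation, in the shape in which it is rewritten with. *)
Lemma bernstein_comb n h1 h2 (a b x : R) :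
  (bernstein n (fun k => a * h1 k + b * h2 k)).[x] =
  a * (bernstein n h1).[x] + b * (bernstein n h2).[x].
Proof.
elim: n h1 h2 => [|n IH] h1 h2; first by rewrite /= !hornerC.
rewrite !bernsteinS (IH (h1 \o succn) (h2 \o succn)) IH.
by ring.
Qed.

Lemma bernstein_cst n (c x : R) : (bernstein n (fun=> c)).[x] = c.
Proof.
elim: n => [|n IH]; first by rewrite /= hornerC.
rewrite bernsteinS.
have -> : (fun=> c) \o succn = (fun=> c) :> (nat -> R) by [].
by rewrite IH; ring.
Qed.

Lemma bernstein_le n h1 h2 (x : R) : 0 <= x <= 1 ->
  (forall k, (k <= n)%N -> h1 k <= h2 k) ->
  (bernstein n h1).[x] <= (bernstein n h2).[x].
Proof.
move=> /andP[x0 x1]; elim: n h1 h2 => [|n IH] h1 h2 le_h.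
  by rewrite /= !hornerC le_h.
rewrite !bernsteinS lerD// ler_wpM2l ?subr_ge0//; apply: IH => k kn.
  by apply: le_h.
by rewrite le_h// leqW.
Qed.

(** Second moment of the binomial law about c: variance plus squared bias. The
free parameter c lets the induction absorb the shift of h. *)
Lemma bernstein_var n (c x : R) :
  (bernstein n (fun k => (k%:R - c) ^+ 2)).[x] =
  n%:R * (x * (1 - x)) + (n%:R * x - c) ^+ 2.
Proof.
elim: n c => [|n IH] c; first by rewrite /= hornerC; ring.
rewrite bernsteinS IH.
have -> : (fun k => (k%:R - c) ^+ 2) \o succn =
          (fun k => (k%:R - (c - 1)) ^+ 2) :> (nat -> R).
  by apply/funext => k /=; rewrite -natr1; ring.
by rewrite IH -natr1; ring.
Qed.

Lemma unif_continuous_itv f (a b e : R) : {within `[a, b], continuous f} ->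
  0 < e -> exists2 d, 0 < d & forall x y, a <= x <= b -> a <= y <= b ->
    `|x - y| < d -> `|f x - f y| <= e.
Proof.
move=> /subspace_continuousP fc e0.
have /compact_near_coveringP/(_ R (0^'+)%R
  (fun d x => a <= x <= b -> forall y, a <= y <= b ->
     `|x - y| < d -> `|f x - f y| <= e)) := @segment_compact R a b.
have fin x0 : `[a, b]%classic x0 -> exists2 r, 0 < r & forall y, a <= y <= b ->
    `|x0 - y| < r -> `|f x0 - f y| <= e / 2.
  move=> abx0; have := fc _ abx0 => /cvgrPdist_le/(_ (e / 2)).
  rewrite divr_gt0// => /(_ isT).
  rewrite near_withinE/= => /nbhs_ballP[r /= r0 Hr].
  by exists r => // y yab xy; apply: Hr; rewrite ?in_itv.
move=> /(_ _ _)-nearP.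
near ((0:R)^'+)%R => d; exists d; first by near: d; exact: nbhs_right_gt.
move=> x y xab yab; suff /(_ x): `[a, b]%classic `<=` (fun x => a <= x <= b ->
  forall y, a <= y <= b -> `|x - y| < d -> `|f x - f y| <= e).
  by rewrite /= in_itv/=; apply.
near: d; apply: nearP.
  move=> x0 abx0; have [r r0 Hr] := fin _ abx0.
  exists (ball x0 (r / 2), [set d | d < r / 2]).
    split => /=; first by apply: nbhsx_ballx; rewrite divr_gt0.
    by apply: nbhs_right_lt; rewrite divr_gt0.
  move=> [x d] [/= xx0 dr] xab y yab xy.
  have -> : f x - f y = (f x0 - f y) - (f x0 - f x) by ring.
  rewrite (le_trans (ler_normB _ _))// [leRHS]splitr lerD//; apply: Hr => //.
    rewrite /ball/= in xx0.
    have -> : x0 - y = (x0 - x) + (x - y) by ring.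
    by rewrite (le_lt_trans (ler_normD _ _))// [ltRHS]splitr ltrD// (lt_trans xy).
  by apply: (lt_trans xx0); lra.
Unshelve. all: by end_near.
Qed.

(** For x and y far apart the quadratic term alone dominates the oscillation of f;
a quadratic modulus is what integrates to the variance in Bernstein's proof. *)
Lemma quadratic_modulus f (a b e : R) : {within `[a, b], continuous f} ->
  0 < e -> exists2 C, 0 <= C & forall x y, a <= x <= b -> a <= y <= b ->
    `|f x - f y| <= e + C * (x - y) ^+ 2.
Proof.
move=> fc e0; have [d d0 Hd] := unif_continuous_itv fc e0.
have [ab|ba] := leP a b; last first.
  by exists 0 => // x y /andP[ax xb]; have := le_trans ax xb; rewrite leNgt ba.
have [c1 _ Hc1] := EVT_max ab fc; have [c2 c2ab Hc2] := EVT_min ab fc.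
have M0 : 0 <= f c1 - f c2 by rewrite subr_ge0 Hc1.
(* Beyond distance d, ((x - y) / d)^2 >= 1 and the oscillation f c1 - f c2 suffices. *)
exists ((f c1 - f c2) / d ^+ 2); first by rewrite divr_ge0// exprn_ge0// ltW.
move=> x y xab yab; have [xy|xy] := ltP `|x - y| d.
  by rewrite (le_trans (Hd _ _ xab yab xy))// lerDl mulr_ge0 ?sqr_ge0//
     divr_ge0// exprn_ge0// ltW.
have -> : (f c1 - f c2) / d ^+ 2 * (x - y) ^+ 2 =
  (f c1 - f c2) * ((x - y) / d) ^+ 2 by rewrite expr_div_n; ring.
have : `|f x - f y| <= f c1 - f c2.
  rewrite ler_norml.
  have := Hc1 x; have := Hc1 y; have := Hc2 x; have := Hc2 y.
  rewrite !in_itv/= xab yab => /(_ isT)? /(_ isT)? /(_ isT)? /(_ isT)?.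
  lra.
move=> /le_trans; apply; rewrite -[leLHS]add0r lerD ?(ltW e0)//.
rewrite -[leLHS]mulr1 ler_wpM2l//.
by rewrite -real_normK ?num_real// exprn_ege1// normrM normfV (gtr0_norm d0)
  ler_pdivlMr// mul1r.
Qed.

(** Bernstein's proof: with a quadratic modulus, the error of the n-th Bernstein
polynomial is at most e / 2 plus a constant times the variance s (1 - s) / n. *)
Theorem weierstrass f (a b e : R) : {within `[a, b], continuous f} ->
  0 < e -> exists p : {poly R}, forall x, a <= x <= b -> `|p.[x] - f x| <= e.
Proof.
move=> fc e0.
have [ab|ba|<-] := ltgtP a b; last 2 first.
- exists 0 => x /andP[ax xb]; have := le_trans ax xb; by rewrite leNgt ba.
- by exists (f a)%:P => x; rewrite -eq_le => /eqP <-; rewrite hornerC subrr normr0 ltW.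
have e20 : 0 < e / 2 by rewrite divr_gt0.
have [C C0 HC] := quadratic_modulus fc e20.
pose L := b - a; have L0 : 0 < L by rewrite subr_gt0.
(* n >= C L^2 / (e / 2) makes the variance term C L^2 s (1 - s) / n at most e / 2. *)
pose n := (Num.truncn (C * L ^+ 2 / (e / 2))).+1.
have n0 : 0 < n%:R :> R by rewrite ltr0n.
pose h k : R := f (a + L * (k%:R / n%:R)).
exists (bernstein n h \Po (L^-1 *: ('X - a%:P))) => x xab.
rewrite horner_comp; set s := (_ *: _).[x].
have sE : s = (x - a) / L by rewrite /s !hornerE mulrC.
have s01 : 0 <= s <= 1.
  rewrite sE divr_ge0 ?ler_pdivrMr ?mul1r ?subr_ge0 ?(ltW L0)//=; rewrite /L; lra.
have xE : x = a + L * s by rewrite sE mulrC divfK ?gt_eqF//; ring.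
pose v k : R := e / 2 * 1 + C * L ^+ 2 / n%:R ^+ 2 * (k%:R - n%:R * s) ^+ 2.
have hv k : (k <= n)%N -> `|h k - f x| <= v k.
  move=> kn; have := HC (a + L * (k%:R / n%:R)) x; rewrite -/(h k) => /(_ _ xab) H.
  apply: (le_trans (H _)).
    have : 0 <= (k%:R / n%:R : R) <= 1.
      by rewrite divr_ge0//= ler_pdivrMr// mul1r ler_nat.
    by move: (_ / _) => t t01; rewrite /L in L0 *; nra.
  rewrite /v mulr1 lerD2l {1}xE le_eqVlt; apply/orP; left; apply/eqP.
  by field; rewrite gt_eqF.
have Ev : (bernstein n v).[s] <= e.
  rewrite (bernstein_comb n (fun=> 1) (fun k => (k%:R - n%:R * s) ^+ 2)).
  rewrite bernstein_cst bernstein_var subrr expr0n addr0 mulr1 [leRHS]splitr lerD2l.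
  have -> : C * L ^+ 2 / n%:R ^+ 2 * (n%:R * (s * (1 - s))) =
    C * L ^+ 2 / n%:R * (s * (1 - s)) by field; rewrite gt_eqF.
  have : C * L ^+ 2 / n%:R <= e / 2.
    rewrite ler_pdivrMr// [leRHS]mulrC -ler_pdivrMr//.
    exact/ltW/Num.Theory.truncnS_gt.
  have : 0 <= C * L ^+ 2 / n%:R by rewrite divr_ge0 ?(ltW n0)// mulr_ge0// sqr_ge0.
  move: (_ / n%:R) => t t0 te; nra.
have E1 : (bernstein n h).[s] - f x = (bernstein n (fun k => 1 * h k + (- f x) * 1)).[s].
  by rewrite (bernstein_comb n h (fun=> 1)) bernstein_cst; ring.
rewrite E1 ler_norml; apply/andP; split; last first.
  rewrite (le_trans _ Ev)// bernstein_le// => k /hv; rewrite ler_norml; lra.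
rewrite lerNl (le_trans _ Ev)//.
have -> : - (bernstein n (fun k => 1 * h k + (- f x) * 1)).[s] =
   (bernstein n (fun k => (-1) * (1 * h k + (- f x) * 1) + 0 * 1)).[s].
  by rewrite (bernstein_comb n (fun k => 1 * h k + (- f x) * 1) (fun=> 1)); ring.
by rewrite bernstein_le// => k /hv; rewrite ler_norml; lra.
Qed.

End Bernstein.

(** * The real inner product and norm bounds of operators *)

Section InnerProduct.
Context {R : realType} {H : hilbertType R}.
Implicit Types (x y z : H) (c : R).
Local Notation Re := complex.Re.

(** The real parts of the inner product and of the norm make the real decision
procedures available: R[i] is only partially ordered. *)
Definition rdot x y : R := Re (hdot x y).
Definition rnorm x : R := Re `|x|.

Lemma hdotC x y : hdot x y = (hdot y x)^*.
Proof. by rewrite (hermC hdot) expr0 mul1r. Qed.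

Lemma rnormE x : `|x| = (rnorm x)%:C.
Proof. by rewrite /rnorm RRe_real// normr_real. Qed.

Lemma rnorm_ge0 x : 0 <= rnorm x.
Proof. by rewrite -ler0c -(rnormE x). Qed.

Lemma rdotxx x : rdot x x = rnorm x ^+ 2.
Proof.
rewrite /rdot.
by have -> : hdot x x = (rnorm x ^+ 2)%:C by rewrite -normr_hdot rnormE rmorphXn.
Qed.

Lemma rdot_ge0 x : 0 <= rdot x x.
Proof. by rewrite rdotxx sqr_ge0. Qed.

Lemma rnorm_eq0 x : (rnorm x == 0) = (x == 0).
Proof. by rewrite -[RHS]normr_eq0 rnormE; apply/esym/(inj_eq (@complexI R)). Qed.

Lemma rnorm0 : rnorm (0 : H) = 0.
Proof. by apply/eqP; rewrite rnorm_eq0. Qed.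

Lemma rnormD x y : rnorm (x + y) <= rnorm x + rnorm y.
Proof.
by have := ler_normD x y; rewrite !rnormE -rmorphD lecR.
Qed.

Lemma rnormZ c x : rnorm (c%:C *: x) = `|c| * rnorm x.
Proof.
have := normrZ (c%:C) x; rewrite !rnormE normc_def /= expr0n addr0 sqrtr_sqr.
by rewrite -rmorphM => /complexI.
Qed.

Lemma rnormN x : rnorm (- x) = rnorm x.
Proof. by have := normrN x; rewrite !rnormE => /complexI. Qed.

Lemma rnormB x y : rnorm (x - y) <= rnorm x + rnorm y.
Proof. by rewrite (le_trans (rnormD _ _))// rnormN. Qed.

Lemma rdotC x y : rdot x y = rdot y x.
Proof. by rewrite /rdot hdotC; case: (hdot y x). Qed.

Lemma ReD (a b : R[i]) : Re (a + b) = Re a + Re b.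
Proof. by case: a b => [a1 a2] [b1 b2]. Qed.

Lemma ReZ c (a : R[i]) : Re (c%:C * a) = c * Re a.
Proof. by case: a => a1 a2 /=; rewrite mul0r subr0. Qed.

Lemma rdotDl x y z : rdot (x + y) z = rdot x z + rdot y z.
Proof. by rewrite /rdot linearDl ReD. Qed.

Lemma rdotDr x y z : rdot z (x + y) = rdot z x + rdot z y.
Proof. by rewrite rdotC rdotDl !(rdotC z). Qed.

Lemma rdotZl c x y : rdot (c%:C *: x) y = c * rdot x y.
Proof. by rewrite /rdot linearZl_LR ReZ. Qed.

Lemma rdotZr c x y : rdot y (c%:C *: x) = c * rdot y x.
Proof. by rewrite rdotC rdotZl rdotC. Qed.

Lemma rdotNl x y : rdot (- x) y = - rdot x y.
Proof. by rewrite -mulN1r -rdotZl rmorphN1 scaleN1r. Qed.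

Lemma rdotNr x y : rdot y (- x) = - rdot y x.
Proof. by rewrite rdotC rdotNl rdotC. Qed.

Definition rdotE := (rdotDl, rdotDr, rdotZl, rdotZr, rdotNl, rdotNr).

Lemma rdot_cauchy_schwarz x y : rdot x y <= rnorm x * rnorm y.
Proof.
have [|y0] := eqVneq (rnorm y) 0.
  move/eqP; rewrite rnorm_eq0 => /eqP ->.
  by rewrite rnorm0 mulr0 -(scale0r (0 : H)) rdotZr mul0r.
have [|x0] := eqVneq (rnorm x) 0.
  move/eqP; rewrite rnorm_eq0 => /eqP ->.
  by rewrite rnorm0 mul0r -(scale0r (0 : H)) rdotZl mul0r.
have := rdot_ge0 ((rnorm y)%:C *: x - (rnorm x)%:C *: y).
rewrite !rdotE (rdotC y x) !rdotxx => h.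
have xy0 : 0 < rnorm x * rnorm y by rewrite mulr_gt0// lt0r ?x0 ?y0 rnorm_ge0.
by rewrite -(ler_pM2l xy0); lra.
Qed.

Lemma ler_sqr_rnorm x y (c : R) : 0 <= c -> rdot x x <= c ^+ 2 * rdot y y ->
  rnorm x <= c * rnorm y.
Proof.
move=> c0; rewrite !rdotxx -exprMn ler_sqr// nnegrE ?rnorm_ge0//.
by rewrite mulr_ge0// rnorm_ge0.
Qed.

End InnerProduct.

Section OperatorAlgebra.
Context {R : realType} {H : hilbertType R}.
Implicit Types (x y z : H) (c : R) (S T U V : bop H).

Lemma bopDE S T x : (S + T) x = S x + T x. Proof. by []. Qed.
Lemma bopNE S x : (- S) x = - S x. Proof. by []. Qed.
Lemma bopBE S T x : (S - T) x = S x - T x. Proof. by []. Qed.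
Lemma bopZE (a : R[i]) S x : (a *: S) x = a *: S x. Proof. by []. Qed.
Lemma bopME S T x : (S * T) x = S (T x). Proof. by []. Qed.
Lemma bop1E x : (1 : bop H) x = x. Proof. by []. Qed.
Lemma bop0E x : (0 : bop H) x = 0. Proof. by []. Qed.
Definition bopE := (bopDE, bopNE, bopZE, bopME, bop1E, bop0E).

Lemma eq_bop S T : (forall x, S x = T x) -> S = T.
Proof. by move=> ST; apply/val_inj/funext. Qed.

Lemma bop_linearP T (a : R[i]) x y : T (a *: x + y) = a *: T x + T y.
Proof. by have [lT _] := asboolP _ (bop_funP T); rewrite lT. Qed.

Lemma bop_xD T x y : T (x + y) = T x + T y.
Proof. by have := bop_linearP T 1 x y; rewrite !scale1r. Qed.
Lemma bop_x0 T : T 0 = 0.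
Proof. by apply: (addrI (T 0)); rewrite -bop_xD !addr0. Qed.
Lemma bop_xZ T (a : R[i]) x : T (a *: x) = a *: T x.
Proof. by have := bop_linearP T a x 0; rewrite bop_x0 !addr0. Qed.
Lemma bop_xN T x : T (- x) = - T x.
Proof. by rewrite -scaleN1r bop_xZ scaleN1r. Qed.

Lemma bop_scaleAl (a : R[i]) S T : (a *: S) * T = a *: (S * T).
Proof. exact: eq_bop. Qed.
Lemma bop_scaleAr (a : R[i]) S T : S * (a *: T) = a *: (S * T).
Proof. by apply: eq_bop => x; rewrite !bopE bop_xZ. Qed.

(** For c >= 0 this is opnorm T <= c (see [opnorm_le]), without the infimum. *)
Definition bounded_by T c := forall x, rnorm (T x) <= c * rnorm x.

Lemma bounded_byE T c :
  bounded_by T c <-> forall x, `|T x| <= c%:C * `|x|.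
Proof.
by split=> h x; move: (h x); rewrite !rnormE -rmorphM lecR.
Qed.

Lemma bounded_by_exists T : exists2 c, 0 < c & bounded_by T c.
Proof.
have [_ [M /bounded_byE hM]] := asboolP _ (bop_funP T).
exists (`|M| + 1); first by rewrite ltr_wpDl.
move=> x; rewrite (le_trans (hM x))// ler_wpM2r ?rnorm_ge0//.
by rewrite (le_trans (ler_norm _))// lerDl.
Qed.

Lemma bounded_byW T c d : c <= d -> bounded_by T c -> bounded_by T d.
Proof. by move=> cd h x; rewrite (le_trans (h x))// ler_wpM2r// rnorm_ge0. Qed.

Lemma bounded_byD S T c d :
  bounded_by S c -> bounded_by T d -> bounded_by (S + T) (c + d).
Proof.
move=> hS hT x; rewrite (le_trans (rnormD _ _))// mulrDl.
by apply: lerD; [exact: hS|exact: hT].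
Qed.

Lemma bounded_byZ T (a c : R) :
  bounded_by T c -> bounded_by (a%:C *: T) (`|a| * c).
Proof. move=> hT x; rewrite bopZE rnormZ -mulrA ler_wpM2l//; exact: hT. Qed.

Lemma bounded_byN T c : bounded_by T c -> bounded_by (- T) c.
Proof. by move=> hT x; rewrite bopNE rnormN; exact: hT. Qed.

Lemma bounded_byB S T c d :
  bounded_by S c -> bounded_by T d -> bounded_by (S - T) (c + d).
Proof. by move=> hS hT; apply: bounded_byD => //; exact: bounded_byN. Qed.

Lemma bounded_byM S T c d : 0 <= c ->
  bounded_by S c -> bounded_by T d -> bounded_by (S * T) (c * d).
Proof.
move=> c0 hS hT x; rewrite bopME (le_trans (hS _))// -mulrA ler_wpM2l//.
Qed.

Lemma bounded_by1 : bounded_by 1 1.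
Proof. by move=> x; rewrite bop1E mul1r. Qed.

Lemma bounded_by0_eq T : (forall e, 0 < e -> bounded_by T e) -> T = 0.
Proof.
move=> h; apply: eq_bop => x; rewrite bop0E; apply/eqP; rewrite -rnorm_eq0.
rewrite eq_le rnorm_ge0 andbT; apply/ler_addgt0Pl => e e0; rewrite addr0.
have x1 : 0 < rnorm x + 1 by rewrite ltr_wpDl ?rnorm_ge0.
rewrite (le_trans (h (e / (rnorm x + 1)) _ x)) ?divr_gt0//.
rewrite -mulrA ger_pMr// mulrC ler_pdivrMr// mul1r lerDl ler01//.
Qed.

Lemma opnorm_le T c : 0 <= c -> opnorm T <= c <-> bounded_by T c.
Proof.
move=> c0; split=> [Tc|Tc].
  apply: bounded_byW Tc _ => x; have [->|x0] := eqVneq x 0.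
    by rewrite bop_x0 rnorm0 mulr0.
  have nx0 : 0 < rnorm x by rewrite lt0r rnorm_eq0 x0 rnorm_ge0.
  rewrite -ler_pdivrMr//; apply: lb_le_inf.
    have [d d0 hd] := bounded_by_exists T.
    by exists d; split; [exact: ltW|apply/bounded_byE].
  by move=> M [_ /bounded_byE hM]; rewrite ler_pdivrMr.
apply: ge_inf; first by exists 0 => M [].
by split=> //; apply/bounded_byE.
Qed.

End OperatorAlgebra.

(** * Self-adjoint operators, invertibility and completeness *)

Section SelfAdjoint.
Context {R : realType} {H : hilbertType R}.
Implicit Types (x y z : H) (c : R) (S T U V : bop H).

Lemma sa_rdot T x y : self_adjoint T -> rdot (T x) y = rdot x (T y).
Proof. by move=> sT; rewrite /rdot sT. Qed.

Lemma sa0 : self_adjoint (0 : bop H).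
Proof. by move=> x y; rewrite !bop0E linear0l linear0r. Qed.

Lemma sa1 : self_adjoint (1 : bop H).
Proof. by []. Qed.

Lemma saD S T : self_adjoint S -> self_adjoint T -> self_adjoint (S + T).
Proof. by move=> sS sT x y; rewrite !bopDE linearDl linearDr /= sS sT. Qed.

Lemma saZ c T : self_adjoint T -> self_adjoint (c%:C *: T).
Proof.
move=> sT x y; rewrite !bopZE linearZl_LR linearZr_LR /= sT.
by have -> : ((c%:C)^*)%R = c%:C by exact: conjc_real.
Qed.

Lemma saN T : self_adjoint T -> self_adjoint (- T).
Proof. by move=> sT x y; rewrite !bopNE linearNl linearNr /= sT. Qed.

Lemma saB S T : self_adjoint S -> self_adjoint T -> self_adjoint (S - T).
Proof. by move=> sS sT; apply: saD => //; exact: saN. Qed.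

Lemma saX T n : self_adjoint T -> self_adjoint (T ^+ n).
Proof.
move=> sT; elim: n => [|n IH]; first exact: sa1.
by move=> x y; rewrite exprS bopME sT IH -bopME -exprSr exprS.
Qed.

Lemma sa_scal c : self_adjoint (scal_op c : bop H).
Proof. by apply: saZ; exact: sa1. Qed.

Lemma sa_horner (p : {poly R}) T : self_adjoint T -> self_adjoint (horner_op p T).
Proof.
move=> sT; rewrite /horner_op; elim/big_ind: _ => [|U V|i _].
- exact: sa0.
- exact: saD.
- by apply: saZ; apply: saX.
Qed.

(** Positivity of the complex form forces self-adjointness: polarization along
x + y and x + 'i y. *)
Lemma positive_opP T :
  positive_op T <-> self_adjoint T /\ forall x, 0 <= rdot (T x) x.
Proof.
split=> [pT|[sT pT] x]; last first.
  rewrite lecE /= pT andbT; have : hdot (T x) x = (hdot (T x) x)^*.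
    by rewrite [LHS]sT hdotC.
  case: (hdot _ _) => a b [] b0; apply/eqP => /=; lra.
split=> [x y|x]; last by have := pT x; rewrite lecE => /andP[].
have im0 z : complex.Im (hdot (T z) z) = 0 by apply: ger0_Im; exact: pT.
rewrite (hdotC x (T y)); have := im0 (x + y); have := im0 (x + 'i *: y).
rewrite !bop_xD !bop_xZ !linearDl !linearDr /= !linearZl_LR /= !linearZr_LR /=.
have := im0 x; have := im0 y.
case: (hdot (T x) x) => a1 a2; case: (hdot (T y) y) => b1 b2.
case: (hdot (T x) y) => p1 p2; case: (hdot (T y) x) => q1 q2. rewrite /=.
move=> h1 h2 h3 h4; have -> : p1 = q1 by lra.
by have -> : p2 = - q2 by lra.
Qed.

Lemma positive_sa T : positive_op T -> self_adjoint T.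
Proof. by case/positive_opP. Qed.

Lemma scal_opE c x : (scal_op c : bop H) x = c%:C *: x.
Proof. by []. Qed.

Lemma ge_scal_opP c T : scal_op c <=op T <->
  self_adjoint T /\ forall x, c * rdot x x <= rdot (T x) x.
Proof.
split=> [/positive_opP[sT pT]|[sT pT]].
  split=> [|x].
    by rewrite -(subrK (scal_op c) T); apply: saD => //; exact: sa_scal.
  by have := pT x; rewrite bopBE scal_opE !rdotE subr_ge0.
apply/positive_opP; split; first by apply: saB => //; exact: sa_scal.
by move=> x; rewrite bopBE scal_opE !rdotE subr_ge0.
Qed.

Lemma le_scal_opP c T : T <=op scal_op c <->
  self_adjoint T /\ forall x, rdot (T x) x <= c * rdot x x.
Proof.
split=> [/positive_opP[sT pT]|[sT pT]].
  split=> [|x].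
    have -> : T = scal_op c - (scal_op c - T) by rewrite opprB addrC subrK.
    by apply: saB => //; exact: sa_scal.
  by have := pT x; rewrite bopBE scal_opE !rdotE subr_ge0.
apply/positive_opP; split; first by apply: saB => //; exact: sa_scal.
by move=> x; rewrite bopBE scal_opE !rdotE subr_ge0.
Qed.

(** Nonnegativity of the form of P at c x - P x, together with its upper bound at
P x; this replaces the square root of P in |P x|^2 <= c <P x, x>. *)
Lemma psd_sqr_le P c : self_adjoint P -> 0 < c ->
  (forall x, 0 <= rdot (P x) x <= c * rdot x x) ->
  forall x, rdot (P x) (P x) <= c * rdot (P x) x.
Proof.
move=> sP c0 hP x.
have /andP[+ _] := hP (c%:C *: x - P x).
have /andP[_ hPx] := hP (P x).
rewrite bop_xD bop_xN bop_xZ !rdotE (sa_rdot (P x) x sP).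
move: hPx; set u := rdot (P (P x)) _; set v := rdot (P x) (P x).
move=> uv h; rewrite -(ler_pM2l c0); move: h; nra.
Qed.

(** [psd_sqr_le] for T + c, which lies between 0 and 2 c. *)
Lemma sa_bounded_by T c : self_adjoint T -> 0 < c ->
  (forall x, - (c * rdot x x) <= rdot (T x) x <= c * rdot x x) ->
  bounded_by T c.
Proof.
move=> sT c0 hT x; apply: ler_sqr_rnorm; first exact: ltW.
have c20 : 0 < 2 * c by rewrite mulr_gt0.
have sP : self_adjoint (T + scal_op c) by apply: saD => //; exact: sa_scal.
have := @psd_sqr_le (T + scal_op c) (2 * c) sP c20.
have h y : 0 <= rdot ((T + scal_op c) y) y <= 2 * c * rdot y y.
  by rewrite bopDE scal_opE !rdotE; have := hT y; lra.
move=> /(_ h x); rewrite bopDE scal_opE !rdotE (rdotC x (T x)); lra.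
Qed.

Lemma bounded_by_rdot T c x : bounded_by T c ->
  - (c * rdot x x) <= rdot (T x) x <= c * rdot x x.
Proof.
move=> hT; have {}hT := hT x; rewrite !rdotxx; have nx := rnorm_ge0 x.
have h1 := rdot_cauchy_schwarz (T x) x.
have := rdot_cauchy_schwarz (- T x) x; rewrite rdotNl rnormN => h2.
have : rnorm (T x) * rnorm x <= c * rnorm x * rnorm x by rewrite ler_wpM2r.
nra.
Qed.

Definition invertible T := exists S, S * T = 1 /\ T * S = 1.

Lemma spectrumE T (l : R[i]) : spectrum T l = ~ invertible (T - l *: (1 : bop H)).
Proof. by []. Qed.

Lemma invertible_lr T U V : U * T = 1 -> T * V = 1 -> invertible T.
Proof.
move=> UT TV; exists U; split=> //.
by have -> : U = V by rewrite -[LHS]mulr1 -TV mulrA UT mul1r.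
Qed.

Lemma invertibleM S T : invertible S -> invertible T -> invertible (S * T).
Proof.
move=> [S' [S1 S2]] [T' [T1 T2]]; exists (T' * S'); split.
  by rewrite mulrA -(mulrA T') S1 mulr1.
by rewrite mulrA -(mulrA S) T2 mulr1.
Qed.

Lemma invertible_comm S T : S * T = T * S -> invertible (S * T) -> invertible S.
Proof.
move=> ST [U [U1 U2]]; apply: (@invertible_lr _ (U * T) (T * U)).
  by rewrite -mulrA -ST.
by rewrite mulrA.
Qed.

Lemma invertibleZ (a : R[i]) T : a != 0 -> invertible T -> invertible (a *: T).
Proof.
move=> a0 [S [S1 S2]]; exists (a^-1 *: S); split.
  by rewrite bop_scaleAl bop_scaleAr scalerA mulVf// scale1r.
by rewrite bop_scaleAl bop_scaleAr scalerA mulfV// scale1r.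
Qed.

Lemma hilbert_complete (u : nat -> H) :
  (forall e : R, 0 < e -> exists N, forall i j, (N <= i)%N -> (N <= j)%N ->
     rnorm (u i - u j) <= e) ->
  exists l, forall e : R, 0 < e -> exists N, forall i, (N <= i)%N ->
     rnorm (u i - l) <= e.
Proof.
move=> uC.
have Re_pos (e : R[i]) : 0 < e -> e = (complex.Re e)%:C /\ 0 < complex.Re e.
  case: e => a b; rewrite ltcE /= => /andP[/eqP -> a0].
  by split.
have /cauchy_cvg/cvg_ex[l ul] : cauchy (u @ \oo).
  apply/cauchy_ballP => e /Re_pos[-> e0].
  have e20 : 0 < complex.Re e / 2 by rewrite divr_gt0.
  have [N hN] := uC _ e20.
  pose A := [set z | exists2 i, (N <= i)%N & z = u i].
  have FA : (u @ \oo) A by exists N => // i /= Ni; exists i.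
  exists (A, A) => //= -[_ _] [[i /= Ni ->] [j /= Nj ->]].
  rewrite -ball_normE /= rnormE ltcR (le_lt_trans (hN _ _ Ni Nj))//.
  by rewrite gtr_pMr// invf_lt1// ltr1n.
exists l => e e0.
have ec0 : 0 < e%:C :> R[i] by rewrite ltcR.
have /cvgrPdist_lt/(_ _ ec0)[N _ hN] := ul.
exists N => i Ni; have := hN i Ni; rewrite /= rnormE ltcR => /ltW.
by rewrite -rnormN opprB.
Qed.

Definition op_converges (S_ : nat -> bop H) S := forall e : R, 0 < e ->
  exists N, forall i, (N <= i)%N -> bounded_by (S_ i - S) e.

(** The pointwise limits form a linear map, and letting j tend to infinity in the
Cauchy condition bounds the distance of each term to it uniformly. *)
Lemma bop_complete (S_ : nat -> bop H) :
  (forall e : R, 0 < e -> exists N, forall i j, (N <= i)%N -> (N <= j)%N ->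
     bounded_by (S_ i - S_ j) e) ->
  exists S, op_converges S_ S.
Proof.
move=> SC.
have ptC x : exists l, forall e : R, 0 < e -> exists N, forall i, (N <= i)%N ->
     rnorm (S_ i x - l) <= e.
  apply: hilbert_complete => e e0.
  have x1 : 0 < rnorm x + 1 by rewrite ltr_wpDl ?rnorm_ge0.
  have [N hN] := SC (e / (rnorm x + 1)) (divr_gt0 e0 x1).
  exists N => i j Ni Nj; rewrite (le_trans (hN i j Ni Nj x))//.
  by rewrite mulrAC ler_pdivrMr// ler_wpM2l ?(ltW e0)// lerDl.
pose L x := sval (cid (ptC x)).
have LP x (e : R) : 0 < e -> exists N, forall i, (N <= i)%N -> rnorm (S_ i x - L x) <= e.
  by move=> e0; rewrite /L; case: cid => l /= /(_ e e0).
have Leq x l : (forall e : R, 0 < e ->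
    exists2 i, rnorm (S_ i x - L x) <= e & rnorm (S_ i x - l) <= e) -> L x = l.
  move=> h; apply/eqP; rewrite -subr_eq0 -rnorm_eq0 eq_le rnorm_ge0 andbT.
  apply/ler_addgt0Pl => e e0; rewrite addr0.
  have [i h1 h2] := h (e / 2) (divr_gt0 e0 (ltr0n _ 2)).
  have -> : L x - l = (S_ i x - l) - (S_ i x - L x) by rewrite opprB [RHS]addrC addrA subrK.
  by rewrite (le_trans (rnormB _ _))// [leRHS]splitr lerD.
have Lbound (e : R) : 0 < e -> exists N, forall i x, (N <= i)%N ->
    rnorm (S_ i x - L x) <= e * rnorm x.
  move=> e0; have [N hN] := SC e e0; exists N => i x Ni.
  apply/ler_addgt0Pl => d d0.
  have [N' hN'] := LP x d d0; pose j := maxn N N'.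
  have -> : S_ i x - L x = (S_ j x - L x) + (S_ i x - S_ j x).
    by rewrite [RHS]addrC addrA subrK.
  rewrite (le_trans (rnormD _ _))// lerD//; first by rewrite hN'// leq_maxr.
  by have := hN i j Ni (leq_maxl _ _) x; rewrite bopBE.
have L_lin : linear L.
  move=> a x y; apply: Leq => e e0.
  (* The error at x is amplified by |a|, and the one at y is added: d (|a| + 1) = e. *)
pose d := e / (complex.Re `|a| + 1).
  have a0 : 0 <= complex.Re `|a| by case: a {d} => a b; rewrite normc_def /= sqrtr_ge0.
  have d0 : 0 < d by rewrite divr_gt0// ltr_wpDl.
  have [N1 h1] := LP x d d0; have [N2 h2] := LP y d d0.
  have [N3 h3] := LP (a *: x + y) e e0.
  pose i := maxn N1 (maxn N2 N3); exists i.
    by rewrite h3// /i !leq_max leqnn !orbT.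
  rewrite bop_linearP opprD addrACA -scalerBr (le_trans (rnormD _ _))//.
  have {}h1 := h1 i (leq_maxl _ _).
  have {}h2 : rnorm (S_ i y - L y) <= d by rewrite h2// /i !leq_max leqnn !orbT.
  have -> : rnorm (a *: (S_ i x - L x)) = complex.Re `|a| * rnorm (S_ i x - L x).
    apply: complexI; rewrite rmorphM RRe_real ?normr_real//.
    by have := normrZ a (S_ i x - L x); rewrite rnormE => ->; rewrite rnormE.
  have -> : e = complex.Re `|a| * d + d.
    by rewrite -{2}[d]mul1r -mulrDl mulrC divfK// gt_eqF// ltr_wpDl.
  by rewrite lerD// ler_wpM2l.
have L_bdd : bounded_linear L.
  apply/asboolP; split=> //.
  have [N hN] := Lbound 1 ltr01.
  have [c c0 hc] := bounded_by_exists (S_ N).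
  exists (c + 1) => x; rewrite !rnormE -rmorphM lecR.
  have -> : L x = S_ N x - (S_ N x - L x) by rewrite opprB [RHS]addrC subrK.
  rewrite (le_trans (rnormB _ _))// mulrDl lerD//.
  exact: hN.
exists (Bop L_bdd) => e e0; have [N hN] := Lbound e e0.
by exists N => i Ni x; exact: hN.
Qed.

End SelfAdjoint.

(** * The spectrum of a self-adjoint operator *)

Section Spectrum.
Context {R : realType} {H : hilbertType R}.
Implicit Types (x y z : H) (c : R) (S T U V : bop H).

Lemma bounded_byX T (r : R) n : 0 <= r -> bounded_by T r ->
  bounded_by (T ^+ n) (r ^+ n).
Proof.
move=> r0 hT; elim: n => [|n IH]; first by rewrite !expr0; exact: bounded_by1.
by rewrite !exprS; exact: bounded_byM.
Qed.

(** The inverse is the limit of the partial sums of the geometric series. *)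
Lemma neumann T (r : R) : 0 <= r -> r < 1 -> bounded_by T r ->
  invertible (1 - T).
Proof.
move=> r0 r1 hT; pose N_ k := \sum_(i < k) T ^+ i.
have r10 : 0 < 1 - r by rewrite subr_gt0.
have hN k d : bounded_by (N_ (k + d)%N - N_ k) (r ^+ k / (1 - r) * (1 - r ^+ d)).
  elim: d => [|d IH].
    by rewrite addn0 subrr expr0 subrr mulr0 => x; rewrite bop0E rnorm0 mul0r.
  rewrite addnS /N_ big_ord_recr /= -/(N_ _) addrAC.
  have -> : r ^+ k / (1 - r) * (1 - r ^+ d.+1) =
    r ^+ k / (1 - r) * (1 - r ^+ d) + r ^+ (k + d).
    by rewrite exprD exprS; field; rewrite gt_eqF.
  apply: bounded_byD IH _; exact: bounded_byX.
have small (e : R) : 0 < e -> exists N, forall k, (N <= k)%N -> r ^+ k <= e.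
  move=> e0; have rn : `|r| < 1 by rewrite ger0_norm.
  have /cvgrPdist_le/(_ e e0)[N _ h] := cvg_expr rn.
  exists N => k /h /=; rewrite sub0r normrN ger0_norm//.
  by rewrite exprn_ge0.
have [S hS] : exists S, op_converges N_ S.
  apply: bop_complete => e e0.
  have [N hr] := small (e * (1 - r)) (mulr_gt0 e0 r10).
  have key i j : (N <= j)%N -> (j <= i)%N -> bounded_by (N_ i - N_ j) e.
    move=> Nj ji; rewrite -(subnKC ji); apply: bounded_byW (hN _ _).
    rewrite -[leRHS]mulr1 ler_pM ?subr_ge0 ?exprn_ile1 ?(ltW r1)//.
    - by rewrite divr_ge0 ?exprn_ge0// ltW.
    - by rewrite ler_pdivrMr// hr.
    - by rewrite lerBlDr lerDl exprn_ge0.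
  exists N => i j Ni Nj; have [ij|/ltnW ij] := leqP j i; first exact: key.
  by rewrite -opprB; apply: bounded_byN; exact: key.
have commN k : T * N_ k = N_ k * T.
  rewrite /N_ mulr_sumr mulr_suml; apply: eq_bigr => i _.
  by rewrite -exprS exprSr.
have telN k : (1 - T) * N_ k = 1 - T ^+ k.
  elim: k => [|k IH]; first by rewrite /N_ big_ord0 mulr0 expr0 subrr.
  rewrite /N_ big_ord_recr /= -/(N_ _) mulrDr IH mulrBl mul1r exprS.
  by rewrite addrA subrK.
have [c c0 hc] := bounded_by_exists (1 - T).
(* Left and right multiplication by 1 - T are handled at once as a Lipschitz map F. *)
have lim (F : bop H -> bop H) : (forall k, F (N_ k) = 1 - T ^+ k) ->
   (forall U V (d : R), 0 <= d -> bounded_by (U - V) d -> bounded_by (F U - F V) (c * d)) ->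
   F S = 1.
  move=> FN Fb; apply/eqP; rewrite -subr_eq0; apply/eqP.
  apply: bounded_by0_eq => e e0; have e20 : 0 < e / 2 by rewrite divr_gt0.
  have [k1 h1] := hS (e / 2 / c) (divr_gt0 e20 c0).
  have [k2 h2] := small (e / 2) e20.
  pose k := maxn k1 k2.
  have -> : F S - 1 = - (F (N_ k) - F S) - T ^+ k.
    by rewrite FN; move: (F S) (T ^+ k) => A B; rewrite !opprB addrA addrAC addrK.
  rewrite [e]splitr; apply: bounded_byB.
    apply: bounded_byN; have := h1 k (leq_maxl _ _) => /Fb.
    have -> : c * (e / 2 / c) = e / 2 by rewrite mulrC divfK// gt_eqF.
    by apply; rewrite divr_ge0 ?ltW.
  by apply: bounded_byW (h2 k (leq_maxr _ _)) _; exact: bounded_byX.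
exists S; split.
  apply: (lim (fun U => U * (1 - T))) => [k|U V d d0 hd].
    by rewrite mulrBr mulr1 -commN -[X in X - _]mul1r -mulrBl telN.
  by rewrite -mulrBl mulrC; apply: bounded_byM.
apply: (lim (fun U => (1 - T) * U)) => // U V d d0 hd.
by rewrite -mulrBr; apply: bounded_byM => //; exact: ltW.
Qed.

(** For L = c + K with K a bound of T, the operator T / L is at distance at most
1 - c / L < 1 from the identity, so the Neumann series inverts it. *)
Lemma sa_coercive_invertible T c : self_adjoint T -> 0 < c ->
  (forall x, c * rdot x x <= rdot (T x) x) -> invertible T.
Proof.
move=> sT c0 hT.
have [K K0 hK] := bounded_by_exists T.
pose L := c + K; have L0 : 0 < L by rewrite addr_gt0.
have cL : c / L < 1 by rewrite ltr_pdivrMr// mul1r ltrDl.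
have cL0 : 0 < c / L by rewrite divr_gt0.
pose E := 1 - (L^-1)%:C *: T.
have -> : T = L%:C *: (1 - E).
  rewrite /E opprB addrC subrK scalerA -rmorphM mulfV ?scale1r ?rmorph1 ?scale1r//.
  by rewrite gt_eqF.
apply: invertibleZ; first by rewrite fmorph_eq0 gt_eqF.
apply: (@neumann _ (1 - c / L)); rewrite ?subr_ge0 ?ltrBlDr ?ltrDl ?(ltW cL)//.
apply: sa_bounded_by; first by apply: saB sa1 _; exact: saZ.
  by rewrite subr_gt0.
move=> x; rewrite /E bopBE bop1E bopZE !rdotE.
have := hT x; have /andP[_] := bounded_by_rdot x hK; have := rdot_ge0 x.
set q := rdot x x; set t := rdot (T x) x => q0 tK ct.
have -> : (1 - c / L) * q = q - L^-1 * (c * q) by ring.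
have Li0 : 0 < L^-1 by rewrite invr_gt0.
have h1 : L^-1 * (c * q) <= L^-1 * t by rewrite ler_pM2l.
have h2 : L^-1 * t <= L^-1 * (L * q - c * q).
  by rewrite ler_pM2l// /L; lra.
rewrite mulrBr mulKf ?gt_eqF// in h2.
by apply/andP; split; lra.
Qed.


Lemma spectrum_ge c T l : scal_op c <=op T -> spectrum T l%:C -> c <= l.
Proof.
move=> /ge_scal_opP[sT hT] hl; rewrite leNgt; apply/negP => lc; apply: hl.
apply: (@sa_coercive_invertible _ (c - l)); rewrite ?subr_gt0//.
  by apply: saB => //; exact: sa_scal.
by move=> x; rewrite bopBE scal_opE !rdotE mulrBl lerB.
Qed.

Lemma spectrum_le c T l : T <=op scal_op c -> spectrum T l%:C -> l <= c.
Proof.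
move=> /le_scal_opP[sT hT] hl; rewrite leNgt; apply/negP => lc; apply: hl.
have -> : T - l%:C *: (1 : bop H) = (-1) *: (scal_op l - T).
  by rewrite scaleN1r opprB.
apply: invertibleZ; first by rewrite oppr_eq0 oner_eq0.
apply: (@sa_coercive_invertible _ (l - c)); rewrite ?subr_gt0//.
  by apply: saB => //; exact: sa_scal.
by move=> x; rewrite bopBE scal_opE !rdotE mulrBl lerB.
Qed.

(** For l = u + i v with v <> 0, the product of T - l and its conjugate is
(T - u)^2 + v^2, which is bounded below by v^2 > 0. *)
Lemma sa_spectrum_real T (l : R[i]) : self_adjoint T -> spectrum T l ->
  l = (complex.Re l)%:C.
Proof.
move=> sT; case: l => u v hl /=; have [->//|v0] := eqVneq v 0; exfalso.
apply: hl.
have [W WE] : exists W, W = T - u%:C *: (1 : bop H) by eexists.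
have sW : self_adjoint W by rewrite WE; apply: saB => //; exact: sa_scal.
have E1 : T - (u +i* v) *: (1 : bop H) = W - ('i * v%:C) *: (1 : bop H).
  by rewrite WE -addrA -opprD -scalerDl; congr (_ - _ *: _); rewrite [LHS]complexE.
rewrite -/(invertible (T - (u +i* v) *: (1 : bop H))) E1; set a := 'i * v%:C.
have a2 : a * a = - (v ^+ 2)%:C.
  by rewrite /a mulrACA -!expr2 sqr_i mulN1r rmorphXn.
have E2 : (W - a *: (1 : bop H)) * (W + a *: (1 : bop H)) =
    W * W + (v ^+ 2)%:C *: (1 : bop H).
  rewrite mulrDr !mulrBl !bop_scaleAl !bop_scaleAr !mul1r !mulr1 scalerA a2 scaleNr opprK.
  by rewrite -addrA; congr (_ + _); rewrite addrA addNr add0r.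
have E3 : (W + a *: (1 : bop H)) * (W - a *: (1 : bop H)) =
    W * W + (v ^+ 2)%:C *: (1 : bop H).
  rewrite mulrBr !mulrDl !bop_scaleAl !bop_scaleAr !mul1r !mulr1 scalerA a2 scaleNr.
  rewrite opprD opprK.
  by rewrite -addrA; congr (_ + _); rewrite addrA addrN add0r.
apply: (@invertible_comm _ _ _ (W + a *: (1 : bop H))); first by rewrite E2 E3.
rewrite E2; apply: (@sa_coercive_invertible _ (v ^+ 2)).
- by apply: saD; [move=> x y; rewrite !bopME !sW|exact: sa_scal].
- by rewrite exprn_even_gt0.
- by move=> x; rewrite bopDE bopME bopZE bop1E !rdotE lerDr sa_rdot// rdot_ge0.
Qed.

(** The greatest lower bound a of the numerical range is in the spectrum: P = T - a
is positive, so if it had an inverse of norm d then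
|x|^2 <= d^2 |P x|^2 <= d^2 c <P x, x> by [psd_sqr_le], and a could be
increased by 1 / (d^2 c). *)
Lemma min_spectrum T : self_adjoint T -> (exists x : H, x != 0) ->
  exists a : R, spectrum T a%:C /\ scal_op a <=op T.
Proof.
move=> sT [x0 x00].
pose A : set R := [set a | forall x, a * rdot x x <= rdot (T x) x].
have [K K0 hK] := bounded_by_exists T.
have q0 : 0 < rdot x0 x0 by rewrite rdotxx exprn_gt0// lt0r rnorm_eq0 x00 rnorm_ge0.
have hA : has_sup A.
  split; first by exists (- K) => x; have := bounded_by_rdot x hK; lra.
  exists (rdot (T x0) x0 / rdot x0 x0) => a /(_ x0).
  by rewrite ler_pdivlMr.
have supA : A (sup A).
  move=> x; apply/ler_addgt0Pr => e e0.
  have qx1 : 0 < rdot x x + 1 by rewrite ltr_wpDl ?rdot_ge0.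
  have [a Aa ha] := sup_adherent (divr_gt0 e0 qx1) hA.
  have h := Aa x.
  have : (sup A - e / (rdot x x + 1)) * rdot x x <= a * rdot x x.
    by rewrite ler_wpM2r ?rdot_ge0// ltW.
  have : e / (rdot x x + 1) * rdot x x <= e.
    by rewrite mulrAC ler_pdivrMr// ler_wpM2l ?(ltW e0)// lerDl.
  by rewrite mulrBl; lra.
exists (sup A); split; last by apply/ge_scal_opP.
move=> [S [S1 S2]].
set P := _ - _ in S1 S2.
have sP : self_adjoint P by apply: saB => //; exact: sa_scal.
have [c c0 hc] := bounded_by_exists P.
have [d d0 hd] := bounded_by_exists S.
have hP x : 0 <= rdot (P x) x <= c * rdot x x.
  have /andP[_ ->] := bounded_by_rdot x hc; rewrite andbT.
  by rewrite /P bopBE bopZE bop1E !rdotE subr_ge0; exact: supA.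
pose g := (d ^+ 2 * c)^-1; have g0 : 0 < g by rewrite invr_gt0 mulr_gt0// exprn_gt0.
have : A (sup A + g).
  move=> x; have -> : rdot (T x) x = sup A * rdot x x + rdot (P x) x.
    by rewrite /P bopBE bopZE bop1E !rdotE addrC subrK.
  rewrite mulrDl lerD2l /g mulrC ler_pdivrMr ?mulr_gt0 ?exprn_gt0//.
  have := psd_sqr_le sP c0 hP x.
  have : rdot x x <= d ^+ 2 * rdot (P x) (P x).
    have := hd (P x); rewrite -bopME S1 bop1E => h.
    by rewrite !rdotxx -exprMn ler_sqr ?nnegrE ?rnorm_ge0// mulr_ge0 ?rnorm_ge0// ltW.
  move=> h1 h2; apply: (le_trans h1); rewrite [leRHS]mulrC -(mulrA _ c) ler_wpM2l//.
  by rewrite exprn_ge0// ltW.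
move=> /(sup_upper_bound hA); rewrite gerDl leNgt g0//.
Qed.

End Spectrum.

(** * Polynomial functional calculus *)

Section PolynomialCalculus.
Context {R : realType} {H : hilbertType R}.
Implicit Types (x y z : H) (c : R) (S T U V : bop H) (p q : {poly R[i]}).

(** Complex coefficients, so that polynomials split into linear factors. *)
Definition cpoly_op p T : bop H := \sum_(i < size p) p`_i *: T ^+ i.

Lemma cpoly_op_wide n p T : (size p <= n)%N ->
  cpoly_op p T = \sum_(i < n) p`_i *: T ^+ i.
Proof.
move=> pn; rewrite /cpoly_op -!(big_mkord xpredT (fun i => p`_i *: T ^+ i)).
rewrite [RHS](big_cat_nat (n := size p))//= [X in _ = _ + X]big_nat_cond.
rewrite [X in _ = _ + X]big1 ?addr0//.
by move=> i /andP[/andP[pi _] _]; rewrite nth_default// scale0r.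
Qed.

Lemma cpoly_opD p q T : cpoly_op (p + q) T = cpoly_op p T + cpoly_op q T.
Proof.
pose n := maxn (size p) (size q).
rewrite (@cpoly_op_wide n (p + q)) ?(leq_trans (size_polyD _ _))//.
rewrite (@cpoly_op_wide n p) ?leq_maxl// (@cpoly_op_wide n q) ?leq_maxr//.
by rewrite -big_split; apply: eq_bigr => i _; rewrite coefD scalerDl.
Qed.

Lemma cpoly_opZ (a : R[i]) p T : cpoly_op (a *: p) T = a *: cpoly_op p T.
Proof.
rewrite (@cpoly_op_wide (size p)) ?size_scale_leq// /cpoly_op scaler_sumr.
by apply: eq_bigr => i _; rewrite coefZ scalerA.
Qed.

Lemma cpoly_opC (a : R[i]) T : cpoly_op a%:P T = a *: (1 : bop H).
Proof.
rewrite (@cpoly_op_wide 1) ?size_polyC_leq1//.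
by rewrite big_ord_recl big_ord0 addr0 coefC expr0.
Qed.

Lemma cpoly_opMX p T : cpoly_op (p * 'X) T = cpoly_op p T * T.
Proof.
rewrite (@cpoly_op_wide (size p).+1); last first.
  by have [->|p0] := eqVneq p 0; rewrite ?mul0r ?size_poly0// size_mulX.
rewrite big_ord_recl coefMX /= scale0r add0r /cpoly_op mulr_suml.
by apply: eq_bigr => i _; rewrite coefMX /= bop_scaleAl exprSr.
Qed.

Lemma cpoly_opM p q T : cpoly_op (p * q) T = cpoly_op p T * cpoly_op q T.
Proof.
elim/poly_ind: q => [|q a IH].
  have -> : cpoly_op 0 T = 0 by rewrite /cpoly_op size_poly0 big_ord0.
  by rewrite !mulr0 /cpoly_op size_poly0 big_ord0.
rewrite mulrDr !cpoly_opD mulrA !cpoly_opMX IH cpoly_opC mulrDr mulrA.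
by rewrite [p * _]mulrC mul_polyC cpoly_opZ bop_scaleAr mulr1.
Qed.

Lemma cpoly_opX T : cpoly_op 'X T = T.
Proof. by rewrite -['X]mul1r cpoly_opMX cpoly_opC scale1r mul1r. Qed.

Lemma cpoly_op_comp p q T : cpoly_op (p \Po q) T = cpoly_op p (cpoly_op q T).
Proof.
elim/poly_ind: p => [|p a IH].
  by rewrite comp_poly0 /cpoly_op size_poly0 !big_ord0.
by rewrite comp_polyD comp_polyM comp_polyX comp_polyC !cpoly_opD cpoly_opMX
  cpoly_opM !cpoly_opC IH.
Qed.

(** The polynomial splits over R[i], and a product of invertible operators is
invertible. *)
Lemma cpoly_op_invertible p T : p != 0 ->
  (forall z : R[i], root p z -> invertible (T - z *: (1 : bop H))) ->
  invertible (cpoly_op p T).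
Proof.
move=> p0; have [r pE] := closed_field_poly_normal p.
have lp0 : lead_coef p != 0 by rewrite lead_coef_eq0.
move=> hz; rewrite pE cpoly_opZ; apply: invertibleZ => //.
have {hz} : forall z : R[i], z \in r -> invertible (T - z *: (1 : bop H)).
  by move=> z zr; apply: hz; rewrite pE rootZ// root_prod_XsubC.
elim: r {pE} => [|z r IH] hr.
  by rewrite big_nil cpoly_opC scale1r; exists 1; rewrite mulr1.
rewrite big_cons cpoly_opM; apply: invertibleM.
  by rewrite cpoly_opD -polyCN cpoly_opX cpoly_opC scaleNr; apply: hr; rewrite mem_head.
by apply: IH => u ur; apply: hr; rewrite in_cons ur orbT.
Qed.

Implicit Types P Q : {poly R}.
Local Notation toC := (map_poly (real_complex R)).

Lemma horner_opE P T : horner_op P T = cpoly_op (toC P) T.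
Proof.
rewrite /cpoly_op size_map_poly; apply: eq_bigr => i _.
by rewrite coef_map.
Qed.

Lemma horner_opD P Q T : horner_op (P + Q) T = horner_op P T + horner_op Q T.
Proof. by rewrite !horner_opE rmorphD cpoly_opD. Qed.

Lemma horner_opZ c P T : horner_op (c *: P) T = c%:C *: horner_op P T.
Proof. by rewrite !horner_opE map_polyZ cpoly_opZ. Qed.

Lemma horner_opC c T : horner_op c%:P T = scal_op c.
Proof. by rewrite !horner_opE map_polyC cpoly_opC. Qed.

Lemma horner_opX T : horner_op 'X T = T.
Proof. by rewrite !horner_opE map_polyX cpoly_opX. Qed.

Lemma horner_opM P Q T : horner_op (P * Q) T = horner_op P T * horner_op Q T.
Proof. by rewrite !horner_opE rmorphM cpoly_opM. Qed.

Lemma horner_opB P Q T : horner_op (P - Q) T = horner_op P T - horner_op Q T.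
Proof. by rewrite horner_opD -scaleN1r horner_opZ rmorphN1 scaleN1r. Qed.

Lemma horner_op_comp P Q T : horner_op (P \Po Q) T = horner_op P (horner_op Q T).
Proof. by rewrite !horner_opE map_comp_poly cpoly_op_comp. Qed.

(** Otherwise the bottom a < 0 of the numerical range of P(T) is in the spectrum
of P(T); then P - a has a root in the spectrum of T, where P takes the negative
value a. *)
Lemma horner_op_ge0 P T : self_adjoint T ->
  (forall t : R, spectrum T t%:C -> 0 <= P.[t]) -> positive_op (horner_op P T).
Proof.
move=> sT hP; have [/existsNP[x0 x0N]|/contrapT x0] :=
  pselect (~ forall x : H, x = 0); last first.
  by move=> x; rewrite (x0 x) linear0r.
have nz : exists x : H, x != 0 by exists x0; exact/eqP.
have [a [aS aP]] := min_spectrum (sa_horner P sT) nz.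
have [a0|a0] := leP 0 a.
  have /ge_scal_opP[sp hp] := aP; apply/positive_opP; split=> // x.
  by rewrite (le_trans _ (hp x))// mulr_ge0// rdot_ge0.
exfalso; apply: aS.
have -> : horner_op P T - a%:C *: (1 : bop H) = cpoly_op (toC (P - a%:P)) T.
  by rewrite -horner_opE horner_opB horner_opC.
apply: cpoly_op_invertible.
  rewrite map_poly_eq0 subr_eq0; apply/eqP => Pa.
  (* If P is the constant a < 0, any point of the spectrum of T contradicts hP. *)
  have [t [tS _]] := min_spectrum sT nz.
  by have := hP t tS; rewrite Pa hornerC leNgt a0.
move=> z rz; apply: contrapT => zS.
have zE := sa_spectrum_real sT zS; rewrite zE in rz zS.
have := hP _ zS; move: rz; rewrite /root horner_map fmorph_eq0 !hornerE subr_eq0.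
by move=> /eqP ->; rewrite leNgt a0.
Qed.

Lemma horner_op_bounded P T e : self_adjoint T -> 0 < e ->
  (forall t : R, spectrum T t%:C -> `|P.[t]| <= e) ->
  bounded_by (horner_op P T) e.
Proof.
move=> sT e0 hP; apply: sa_bounded_by => //; first exact: sa_horner.
move=> x; apply/andP; split.
  have : positive_op (horner_op (e%:P + P) T).
    apply: horner_op_ge0 => // t /hP; rewrite !hornerE ler_norml; lra.
  move=> /positive_opP[_ /(_ x)].
  by rewrite horner_opD horner_opC bopDE scal_opE !rdotE; lra.
have : positive_op (horner_op (e%:P - P) T).
  apply: horner_op_ge0 => // t /hP; rewrite !hornerE ler_norml; lra.
move=> /positive_opP[_ /(_ x)].
by rewrite horner_opB horner_opC bopBE scal_opE !rdotE; lra.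
Qed.

End PolynomialCalculus.

(** * Continuous functional calculus *)

Section ContinuousCalculus.
Context {R : realType} {H : hilbertType R}.
Implicit Types (x y z : H) (c : R) (S T U V : bop H) (P Q : {poly R}).
Implicit Types (f g : R -> R).

Lemma is_cfcP f T S : is_cfc f T S <-> forall e : R, 0 < e -> exists P,
  (forall t : R, spectrum T t%:C -> `|P.[t] - f t| <= e) /\
  bounded_by (horner_op P T - S) e.
Proof.
by split=> h e e0; have [P [h1 h2]] := h e e0; exists P; split=> //;
  apply/opnorm_le => //; exact: ltW.
Qed.

Lemma is_cfc_horner P T : is_cfc (fun t => P.[t]) T (horner_op P T).
Proof.
apply/is_cfcP => e e0; exists P; split=> [t _|]; first by rewrite subrr normr0 ltW.
by rewrite subrr => x; rewrite bop0E rnorm0 mulr_ge0 ?rnorm_ge0// ltW.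
Qed.

Lemma is_cfcD f g T S U : is_cfc f T S -> is_cfc g T U ->
  is_cfc (fun t => f t + g t) T (S + U).
Proof.
move=> /is_cfcP hf /is_cfcP hg; apply/is_cfcP => e e0.
have e20 : 0 < e / 2 by rewrite divr_gt0.
have [P [hP1 hP2]] := hf _ e20; have [Q [hQ1 hQ2]] := hg _ e20.
exists (P + Q); split=> [t tS|].
  rewrite hornerD opprD addrACA (le_trans (ler_normD _ _))// [leRHS]splitr.
  by rewrite lerD ?hP1 ?hQ1.
by rewrite horner_opD opprD addrACA [e]splitr; exact: bounded_byD.
Qed.

Lemma is_cfcZ c f T S : is_cfc f T S ->
  is_cfc (fun t => c * f t) T (c%:C *: S).
Proof.
move=> /is_cfcP hf; apply/is_cfcP => e e0.
have c1 : 0 < `|c| + 1 by rewrite ltr_wpDl.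
have [P [hP1 hP2]] := hf _ (divr_gt0 e0 c1).
have ce : `|c| * (e / (`|c| + 1)) <= e.
  by rewrite mulrCA ger_pMr// ler_pdivrMr// mul1r lerDl.
exists (c *: P); split=> [t tS|].
  by rewrite hornerZ -mulrBr normrM (le_trans _ ce)// ler_wpM2l// hP1.
rewrite horner_opZ -scalerBr; apply: bounded_byW ce _; exact: bounded_byZ.
Qed.

(** The imaginary part is recovered by replacing y with 'i y. *)
Lemma rdot_sa T : (forall x y, rdot (T x) y = rdot x (T y)) -> self_adjoint T.
Proof.
move=> h x y; have := h x y; have := h x ('i *: y).
rewrite /rdot bop_xZ !linearZr_LR /=.
case: (hdot (T x) y) => a1 a2; case: (hdot x (T y)) => b1 b2 /= h1 ->.
by congr (_ +i* _); lra.
Qed.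

(** The functional calculus only provides norm limits of polynomials, so
self-adjointness has to pass to the limit. *)
Lemma self_adjoint_lim S : (forall e : R, 0 < e ->
  exists2 V, self_adjoint V & bounded_by (V - S) e) -> self_adjoint S.
Proof.
move=> hS; apply: rdot_sa => x y.
suff le u v : rdot (S u) v <= rdot u (S v).
  by apply/eqP; rewrite eq_le le /= [leRHS]rdotC [leLHS]rdotC.
apply/ler_addgt0Pr => e e0.
pose d := 2 * (rnorm u * rnorm v) + 1.
have uv0 : 0 <= rnorm u * rnorm v by rewrite mulr_ge0 ?rnorm_ge0.
have d0 : 0 < d by rewrite ltr_wpDl// mulr_ge0.
have [V sV hV] := hS _ (divr_gt0 e0 d0).
have := sa_rdot u v sV.
have -> : rdot (V u) v = rdot (S u) v + rdot ((V - S) u) v.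
  by rewrite bopBE !rdotE; ring.
have -> : rdot u (V v) = rdot u (S v) + rdot u ((V - S) v).
  by rewrite bopBE !rdotE; ring.
have h1 := rdot_cauchy_schwarz u ((V - S) v).
have h2 := rdot_cauchy_schwarz (- (V - S) u) v.
rewrite rdotNl rnormN in h2.
have h3 : rnorm u * rnorm ((V - S) v) <= e / d * (rnorm u * rnorm v).
  by rewrite mulrCA ler_wpM2l ?rnorm_ge0//; exact: hV.
have h4 : rnorm ((V - S) u) * rnorm v <= e / d * (rnorm u * rnorm v).
  by rewrite mulrA ler_wpM2r ?rnorm_ge0//; exact: hV.
have h5 : e / d * (rnorm u * rnorm v) + e / d * (rnorm u * rnorm v) <= e.
  rewrite -mulrDr mulrAC ler_pdivrMr// ler_wpM2l ?(ltW e0)//.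
  by rewrite /d; lra.
lra.
Qed.

(** The approximating polynomials are nonnegative on the spectrum after adding the
approximation error; their values are positive by [horner_op_ge0] and
positivity passes to the limit. *)
Lemma is_cfc_ge0 f T S : self_adjoint T -> is_cfc f T S ->
  (forall t : R, spectrum T t%:C -> 0 <= f t) -> positive_op S.
Proof.
move=> sT /is_cfcP hf f0.
have hS (e : R) : 0 < e -> exists V, positive_op V /\ bounded_by (V - S) e.
  move=> e0; have e20 : 0 < e / 2 by rewrite divr_gt0.
  have [P [hP1 hP2]] := hf _ e20.
  exists (horner_op (P + (e / 2)%:P) T); split.
    apply: horner_op_ge0 => // t tS; have := hP1 t tS; have := f0 t tS.
    by rewrite !hornerE ler_norml; lra.
  rewrite horner_opD horner_opC addrAC [X in bounded_by _ X]splitr.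
  apply: bounded_byD => //.
  by move=> x; rewrite scal_opE rnormZ gtr0_norm.
have sS : self_adjoint S.
  apply: self_adjoint_lim => e e0; have [V [/positive_sa sV hV]] := hS e e0.
  by exists V.
apply/positive_opP; split=> // x; rewrite -oppr_le0; apply/ler_addgt0Pr => e e0.
have q1 : 0 < rdot x x + 1 by rewrite ltr_wpDl ?rdot_ge0.
have [V [/positive_opP[_ /(_ x) hV] /bounded_by_rdot hVS]] := hS _ (divr_gt0 e0 q1).
have /andP[_] := hVS x; rewrite bopBE !rdotE => h.
have : e / (rdot x x + 1) * rdot x x <= e.
  by rewrite mulrAC ler_pdivrMr// ler_wpM2l ?(ltW e0)// lerDl.
lra.
Qed.

Lemma is_cfc_le f g T S U : self_adjoint T -> is_cfc f T S -> is_cfc g T U ->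
  (forall t : R, spectrum T t%:C -> f t <= g t) -> S <=op U.
Proof.
move=> sT hf hg fg; have := is_cfcD hg (is_cfcZ (-1) hf).
rewrite rmorphN1 scaleN1r => /(is_cfc_ge0 sT); apply => t /fg.
by rewrite mulN1r subr_ge0.
Qed.

(** Polynomials approximating f within 1 / (n + 1) give a Cauchy sequence of
operators by [horner_op_bounded]; the limit is a witness for the choice
in [cfc]. *)
Lemma is_cfc_cfc f T : self_adjoint T ->
  (forall e : R, 0 < e -> exists P,
     forall t : R, spectrum T t%:C -> `|P.[t] - f t| <= e) ->
  is_cfc f T (cfc f T).
Proof.
move=> sT hf; rewrite /cfc.
suff [S hS] : exists S, is_cfc f T S.
  by apply: (@xgetPex _ 0 [set S | is_cfc f T S]); exists S.
have n1 (n : nat) : 0 < n.+1%:R^-1 :> R by rewrite invr_gt0.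
pose P_ n := sval (cid (hf _ (n1 n))).
have PP n t : spectrum T t%:C -> `|(P_ n).[t] - f t| <= n.+1%:R^-1.
  by rewrite /P_; case: cid => P /= h; exact: h.
have small (e : R) : 0 < e -> exists N, forall n, (N <= n)%N -> n.+1%:R^-1 <= e.
  move=> e0; exists (Num.truncn e^-1) => n Nn.
  rewrite -[leRHS]invrK lef_pV2 ?posrE ?invr_gt0//.
  by rewrite (le_trans (ltW (Num.Theory.truncnS_gt _)))// ler_nat.
have [S hS] : exists S, op_converges (fun n => horner_op (P_ n) T) S.
  apply: bop_complete => e e0.
  have [N hN] := small (e / 2) (divr_gt0 e0 (ltr0n _ 2)).
  exists N => i j Ni Nj; rewrite -horner_opB; apply: horner_op_bounded => // t tS.
  have := PP i t tS; have := PP j t tS; have := hN i Ni; have := hN j Nj.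
  rewrite hornerD hornerN !ler_norml.
  by move: (j.+1%:R^-1 : R) (i.+1%:R^-1 : R) (_.[t]) (_.[t]) => *; lra.
exists S; apply/is_cfcP => e e0.
have [N1 h1] := small e e0; have [N2 h2] := hS e e0.
exists (P_ (maxn N1 N2)); split.
  by move=> t tS; rewrite (le_trans (PP _ t tS))// h1// leq_maxl.
by apply: h2; exact: leq_maxr.
Qed.

(** T - t is a factor of P(T) - P(t) that commutes with the cofactor. *)
Lemma spectrum_horner P T (t : R) :
  spectrum T t%:C -> spectrum (horner_op P T) (P.[t])%:C.
Proof.
rewrite !spectrumE => tS hP; apply: tS.
have /factor_theorem[Q QE] : root (P - (P.[t])%:P) t.
  by rewrite /root !hornerE subrr.
have XE : horner_op ('X - t%:P) T = T - t%:C *: (1 : bop H).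
  by rewrite horner_opB horner_opX horner_opC.
have E : horner_op P T - (P.[t])%:C *: (1 : bop H) = horner_op (P - (P.[t])%:P) T.
  by rewrite horner_opB horner_opC.
rewrite -/(invertible (T - t%:C *: (1 : bop H))) -XE.
apply: (@invertible_comm _ _ _ (horner_op Q T)).
  by rewrite -!horner_opM mulrC.
by rewrite -horner_opM mulrC -QE -E.
Qed.

Lemma is_cfc_comp g P T S :
  is_cfc g (horner_op P T) S -> is_cfc (fun t => g P.[t]) T S.
Proof.
move=> /is_cfcP hg; apply/is_cfcP => e e0; have [Q [h1 h2]] := hg e e0.
exists (Q \Po P); split; last by rewrite horner_op_comp.
by move=> t tS; rewrite horner_comp h1//; exact: spectrum_horner.
Qed.

Lemma cfc_continuous f T (a b : R) : {within `[a, b], continuous f} ->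
  scal_op a <=op T -> T <=op scal_op b -> is_cfc f T (cfc f T).
Proof.
move=> fc aT Tb; have [sT _] := (ge_scal_opP _ _).1 aT.
apply: is_cfc_cfc => // e e0.
have [P hP] := weierstrass fc e0.
by exists P => t tS; apply: hP; rewrite (spectrum_ge aT tS) (spectrum_le Tb tS).
Qed.

(** [abs_op] is the square root calculus of (T - c)^2; composing the
approximating polynomials with ('X - c)^2 moves it to T itself. *)
Lemma is_cfc_abs_op c T : self_adjoint T ->
  is_cfc (fun t => `|t - c|) T (abs_op (T - scal_op c)).
Proof.
move=> sT; pose P : {poly R} := ('X - c%:P) ^+ 2.
have PE : horner_op P T = (T - scal_op c) ^+ 2.
  by rewrite /P expr2 horner_opM horner_opB horner_opX horner_opC.
have sW : self_adjoint (T - scal_op c) by apply: saB => //; exact: sa_scal.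
have sW2 := saX 2 sW.
have [K K0 hK] := bounded_by_exists ((T - scal_op c) ^+ 2).
have -> : (fun t => `|t - c|) = (fun t => Num.sqrt (P.[t])).
  by apply/funext => t; rewrite /P !hornerE sqrtr_sqr.
apply: is_cfc_comp; rewrite PE.
apply: (@cfc_continuous _ _ 0 K).
- by apply: continuous_subspaceT; exact: sqrt_continuous.
- apply/ge_scal_opP; split=> // x; rewrite mul0r expr2 bopME sa_rdot//.
  exact: rdot_ge0.
- by apply/le_scal_opP; split=> // x; have /andP[] := bounded_by_rdot x hK.
Qed.

Lemma max_spectrum T : self_adjoint T -> (exists x : H, x != 0) ->
  exists a : R, spectrum T a%:C /\ T <=op scal_op a.
Proof.
move=> sT nz; have [a [aS aT]] := min_spectrum (saN sT) nz.
exists (- a); split.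
  rewrite spectrumE => hT; apply: aS.
  have E : - T - a%:C *: (1 : bop H) = (-1) *: (T - (- a)%:C *: (1 : bop H)).
    by rewrite scaleN1r opprB rmorphN scaleNr addrC.
  rewrite -/(invertible (- T - a%:C *: (1 : bop H))) E; apply: invertibleZ hT.
  by rewrite oppr_eq0 oner_eq0.
move: aT => /ge_scal_opP[_ h]; apply/le_scal_opP; split=> // x.
by have := h x; rewrite bopNE !rdotE; lra.
Qed.

End ContinuousCalculus.

(** * Convex functions and their secants *)

Section Scalar.
Context {R : realType}.
Implicit Types (J : set R) (f : R -> R) (m M t x y : R).

Lemma convex_combination J f x y t : convex_function J f -> J x -> J y ->
  0 <= t <= 1 -> f (t * x + (1 - t) * y) <= t * f x + (1 - t) * f y.
Proof.
move=> cf Jx Jy /andP[t0 t1].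
have := cf (Itv01 t0 t1) x y (mem_set Jx) (mem_set Jy).
by rewrite !convRE.
Qed.

(** Convexity with denominators cleared, so that x = y is allowed. *)
Lemma convex_chord J f x y z : convex_function J f -> J x -> J y ->
  x <= z <= y -> (y - x) * f z <= (y - z) * f x + (z - x) * f y.
Proof.
move=> cf Jx Jy /andP[xz zy].
have [xy|xy] := eqVneq x y.
  have -> : z = x by lra.
  rewrite -xy; lra.
have xy0 : 0 < y - x by lra.
pose t := (y - z) / (y - x).
have t01 : 0 <= t <= 1.
  apply/andP; split; first by rewrite /t divr_ge0 ?subr_ge0// (le_trans xz).
  by rewrite /t ler_pdivrMr// mul1r lerD2l lerN2.
have tE : (y - x) * t = y - z by rewrite /t mulrC divfK// gt_eqF.
have := convex_combination cf Jx Jy t01.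
have -> : t * x + (1 - t) * y = z.
  have -> : t * x + (1 - t) * y = y - (y - x) * t by ring.
  by rewrite tE; ring.
rewrite -(ler_pM2l xy0) => /le_trans; apply.
have -> : (y - x) * (t * f x + (1 - t) * f y) =
  (y - x) * t * f x + ((y - x) - (y - x) * t) * f y by ring.
by rewrite tE; lra.
Qed.

Definition slope f m M : R := (f M - f m) / (M - m).
Definition intercept f m M : R := f m - slope f m M * m.
Definition sec_gap f m M : R := f m + f M - 2 * f ((m + M) / 2).

Lemma secantl f m M : slope f m M * m + intercept f m M = f m.
Proof. by rewrite /intercept; ring. Qed.

Lemma secantr f m M : m < M -> slope f m M * M + intercept f m M = f M.
Proof.
move=> mM; have h : slope f m M * (M - m) = f M - f m.
  by rewrite /slope divfK// gt_eqF// subr_gt0.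
have -> : slope f m M * M + intercept f m M = slope f m M * (M - m) + f m.
  by rewrite /intercept; ring.
by rewrite h; ring.
Qed.

Lemma sec_gap_ge0 J f m M : convex_function J f -> J m -> J M ->
  0 <= sec_gap f m M.
Proof.
move=> cf Jm JM; have t01 : 0 <= (2^-1 : R) <= 1 by lra.
have := convex_combination cf Jm JM t01; rewrite /sec_gap.
have -> : 2^-1 * m + (1 - 2^-1) * M = (m + M) / 2 by field.
lra.
Qed.

(** The right-hand side is affine on each half of [m, M] and agrees with f at m,
at the midpoint and at M, so each half is a chord of f. *)
Lemma convex_le_secant J f m M t : is_interval J -> convex_function J f ->
  J m -> J M -> m < M -> m <= t <= M ->
  f t <= slope f m M * t + (intercept f m M - sec_gap f m M / 2)
         + sec_gap f m M / (M - m) * `|t - (m + M) / 2|.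
Proof.
move=> iJ cf Jm JM mM /andP[mt tM].
have := secantl f m M; have := secantr f mM.
have : sec_gap f m M = f m + f M - 2 * f ((m + M) / 2) by [].
set mid := (m + M) / 2; set a := slope _ _ _; set b := intercept _ _ _.
set d := sec_gap _ _ _ => dE fM fm.
have Jmid : J mid by apply: (iJ m M) => //; rewrite /mid; lra.
have Mm0 : 0 < M - m by rewrite subr_gt0.
pose g := d / (M - m); have gE : g * (M - m) = d by rewrite /g divfK// gt_eqF.
have midE : mid = (m + M) / 2 by [].
rewrite -/g; have [tmid|tmid] := leP t mid.
  have Mm2 : 0 < mid - m by rewrite midE; lra.
  have mtm : m <= t <= mid by rewrite mt.
  rewrite ler0_norm; last by lra.
  have := convex_chord cf Jm Jmid mtm.
  have fmid : f mid = a * mid + b - d / 2 by rewrite midE; lra.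
  move=> h; rewrite -(ler_pM2l Mm2) (le_trans h)// le_eqVlt; apply/orP; left.
  by apply/eqP; rewrite fmid -fm -gE midE; field.
have Mm2 : 0 < M - mid by rewrite midE; lra.
have mtm : mid <= t <= M by rewrite (ltW tmid).
rewrite gtr0_norm; last by lra.
have := convex_chord cf Jmid JM mtm.
have fmid : f mid = a * mid + b - d / 2 by rewrite midE; lra.
move=> h; rewrite -(ler_pM2l Mm2) (le_trans h)// le_eqVlt; apply/orP; left.
by apply/eqP; rewrite fmid -fM -gE midE; field.
Qed.

Lemma secant_le_convex J f m M t : convex_function J f ->
  J m -> J M -> J t -> m < M -> (t <= m) || (M <= t) ->
  slope f m M * t + intercept f m M <= f t.
Proof.
move=> cf Jm JM Jt mM.
have := secantl f m M; have := secantr f mM.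
set a := slope _ _ _; set b := intercept _ _ _ => fM fm.
have Mm0 : 0 < M - m by rewrite subr_gt0.
move=> /orP[tm|Mt].
  have tmM : t <= m <= M by rewrite tm ltW.
  have := convex_chord cf Jt JM tmM; rewrite -fm -fM => h.
  by rewrite -(ler_pM2l Mm0); lra.
have tmM : m <= M <= t by rewrite Mt ltW.
have := convex_chord cf Jm Jt tmM; rewrite -fm -fM => h.
by rewrite -(ler_pM2l Mm0); lra.
Qed.

End Scalar.

(** * Operator inequalities *)

Section Combination.
Context {R : realType} {H : hilbertType R}.

(** SA, ..., SD stand for the arguments of the secant and XB, ..., YD for the values
of f there; which of f and averaging comes first is left open, so that this
covers all three double inequalities. The first difference is the sum of the
four gaps in the hypotheses and the second is d / w times the sum of the gaps in
the bounds of aB and aC. *)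
Lemma secant_combine (a b d w : R) (SA SB SC SD XB XC YA YD aB aC : bop H) :
  0 <= d -> 0 < w -> SA + SD = SB + SC ->
  XB <=op a%:C *: SB + scal_op (b - d / 2) + (d / w)%:C *: aB ->
  XC <=op a%:C *: SC + scal_op (b - d / 2) + (d / w)%:C *: aC ->
  aB <=op scal_op (w / 2) -> aC <=op scal_op (w / 2) ->
  a%:C *: SA + scal_op b <=op YA -> a%:C *: SD + scal_op b <=op YD ->
  let X : bop H := 1 - (1 / w)%:C *: (aB + aC) in
  (XB + XC <=op YA + YD - d%:C *: X) /\ (YA + YD - d%:C *: X <=op YA + YD).
Proof.
move=> d0 w0 ADBC hB hC aBh aCh hA hD X.
have w1 : w != 0 by rewrite gt_eqF.
have dw : (d / w)%:C = d%:C * (1 / w)%:C by rewrite -rmorphM mul1r.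
have ww : (w / 2)%:C * (1 / w)%:C = 2^-1.
  rewrite -rmorphM; have -> : w / 2 * (1 / w) = 2^-1 by field.
  by rewrite fmorphV rmorph_nat.
have d2 : (b - d / 2)%:C = b%:C - d%:C / 2.
  by rewrite rmorphB rmorphM fmorphV rmorph_nat.
split=> x.
  have ADx : SA x = SB x + SC x - SD x by rewrite -bopDE -ADBC bopDE addrK.
  have := addr_ge0 (addr_ge0 (hB x) (hC x)) (addr_ge0 (hA x) (hD x)).
  congr (0 <= _); rewrite /X !bopE ADx.
  rewrite !(linearDl, linearNl, linearZl_LR) /= dw d2.
  by move: ((1 / w)%:C) => k; field.
have dw0 : 0 <= d%:C * (1 / w)%:C :> R[i].
  by rewrite -rmorphM ler0c mul1r divr_ge0// ltW.
have h := mulr_ge0 dw0 (addr_ge0 (aBh x) (aCh x)).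
suff -> : hdot ((YA + YD - (YA + YD - d%:C *: X)) x) x =
  d%:C * (1 / w)%:C * (hdot ((scal_op (w / 2) - aB) x) x
    + hdot ((scal_op (w / 2) - aC) x) x) by exact: h.
rewrite /X !bopE.
rewrite !(linearDl, linearNl, linearZl_LR) /=.
move: ww; move: ((1 / w)%:C) ((w / 2)%:C) (d%:C) => k h2 e ww.
have -> (p q r : R[i]) : e * k * (h2 * p - q + (h2 * p - r)) =
  2 * (h2 * k) * e * p - e * k * (q + r) by ring.
by rewrite ww; field.
Qed.

End Combination.

Section Averaging.
Context {R : realType} {H : hilbertType R} {n : nat}.
Context (Phi : 'I_n -> {linear bop H -> bop H}).
Context (Phi_pos : forall i, positive_map (Phi i)).
Context (Phi_unital : \sum_(i < n) Phi i 1 = 1).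
Implicit Types X Y : 'I_n -> bop H.

Definition average X : bop H := \sum_(i < n) Phi i (X i).

Lemma averageD X Y : average (fun i => X i + Y i) = average X + average Y.
Proof. by rewrite /average -big_split; apply: eq_bigr => i _; rewrite linearD. Qed.

Lemma averageZ (a : R[i]) X : average (fun i => a *: X i) = a *: average X.
Proof. by rewrite /average scaler_sumr; apply: eq_bigr => i _; rewrite linearZ. Qed.

Lemma average_scal (c : R) : average (fun=> scal_op c) = scal_op c.
Proof. by rewrite /scal_op averageZ /average Phi_unital. Qed.

Lemma le_average X Y : (forall i, X i <=op Y i) -> average X <=op average Y.
Proof.
move=> XY; rewrite /le_op /average -sumrB.
elim/big_ind: _ => [x|U V hU hV x|i _].
- by rewrite bop0E linear0l.
- by rewrite bopDE linearDl; apply: addr_ge0; [exact: hU|exact: hV].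
- by rewrite -linearB; apply/Phi_pos/XY.
Qed.

End Averaging.

Section OperatorBounds.
Context {R : realType} {H : hilbertType R}.
Context (J : set R) (f : R -> R) (m M : R).
Context (J_itv : is_interval J) (f_cont : {within J, continuous f}).
Context (f_convex : convex_function J f) (Jm : J m) (JM : J M) (mM : m < M).
Implicit Types (S T U V X Y : bop H).

Let mid := (m + M) / 2.
Let a := slope f m M.
Let b := intercept f m M.
Let d := sec_gap f m M.

Lemma cfc_between T (u v : R) : J u -> J v ->
  scal_op u <=op T -> T <=op scal_op v -> is_cfc f T (cfc f T).
Proof.
move=> Ju Jv uT Tv; apply: (cfc_continuous _ uT Tv).
apply: (continuous_subspaceW _ f_cont) => t /=; rewrite in_itv /= => utv.
exact: (J_itv Ju Jv).
Qed.

Lemma cfc_le_secant T : scal_op m <=op T -> T <=op scal_op M ->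
  cfc f T <=op a%:C *: T + scal_op (b - d / 2)
    + (d / (M - m))%:C *: abs_op (T - scal_op mid).
Proof.
move=> mT TM; have [sT _] := (ge_scal_opP _ _).1 mT.
have h := is_cfcD (is_cfc_horner (a *: 'X + (b - d / 2)%:P) T)
  (is_cfcZ (d / (M - m)) (is_cfc_abs_op mid sT)).
rewrite horner_opD horner_opZ horner_opX horner_opC in h.
apply: (is_cfc_le sT (cfc_between Jm JM mT TM) h) => t tS.
rewrite hornerD hornerZ hornerX hornerC; apply: (convex_le_secant J_itv f_convex) => //.
by rewrite (spectrum_ge mT tS) (spectrum_le TM tS).
Qed.

Lemma abs_op_le T : scal_op m <=op T -> T <=op scal_op M ->
  abs_op (T - scal_op mid) <=op scal_op ((M - m) / 2).
Proof.
move=> mT TM; have [sT _] := (ge_scal_opP _ _).1 mT.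
have h := is_cfc_horner ((M - m) / 2)%:P T; rewrite horner_opC in h.
apply: (is_cfc_le sT (is_cfc_abs_op mid sT) h) => t tS.
have := spectrum_ge mT tS; have := spectrum_le TM tS.
by rewrite hornerC ler_norml /mid => ? ?; apply/andP; split; lra.
Qed.

(** Whether [u, v] lies left of m or right of M is kept as a disjunction: the first
case serves the A_i, the second the D_i. *)
Lemma secant_le_cfc T (u v : R) : J u -> J v -> (v <= m) || (M <= u) ->
  scal_op u <=op T -> T <=op scal_op v ->
  a%:C *: T + scal_op b <=op cfc f T.
Proof.
move=> Ju Jv uv uT Tv; have [sT _] := (ge_scal_opP _ _).1 uT.
have h := is_cfc_horner (a *: 'X + b%:P) T.
rewrite horner_opD horner_opZ horner_opX horner_opC in h.
apply: (is_cfc_le sT h (cfc_between Ju Jv uT Tv)) => t tS.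
have ut := spectrum_ge uT tS; have tv := spectrum_le Tv tS.
rewrite hornerD hornerZ hornerX hornerC; apply: (secant_le_convex f_convex) => //.
  by apply: (J_itv Ju Jv); rewrite ut.
by case/orP: uv => [vm|Mu]; apply/orP; [left|right]; lra.
Qed.

End OperatorBounds.

Section CommonBounds.
Context {R : realType} {H : hilbertType R}.

Lemma scal_op_mono (a b : R) : a <= b -> (scal_op a : bop H) <=op scal_op b.
Proof.
move=> ab; apply/ge_scal_opP; split; first exact: sa_scal.
by move=> x; rewrite scal_opE rdotZl ler_wpM2r// rdot_ge0.
Qed.

Lemma le_op_trans (S T U : bop H) : S <=op T -> T <=op U -> S <=op U.
Proof.
move=> ST TU x; have -> : U - S = (U - T) + (T - S) by rewrite addrA subrK.
by rewrite bopDE linearDl; apply: addr_ge0; [exact: TU|exact: ST].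
Qed.

Lemma scal_op_le_inv (a b : R) (T : bop H) : (exists x : H, x != 0) ->
  scal_op a <=op T -> T <=op scal_op b -> a <= b.
Proof.
move=> [x x0] /ge_scal_opP[_ h1] /le_scal_opP[_ h2].
have q0 : 0 < rdot x x by rewrite rdotxx exprn_gt0// lt0r rnorm_eq0 x0 rnorm_ge0.
by rewrite -(ler_pM2r q0) (le_trans (h1 x)).
Qed.

Lemma sa_spec_in_ge (J : set R) (T : bop H) : (exists x : H, x != 0) ->
  sa_spec_in J T -> exists a : R, J a /\ scal_op a <=op T.
Proof.
move=> nz [sT TJ]; have [a [aS aT]] := min_spectrum sT nz.
by exists a; split=> //; have [t Jt /complexI <-] := TJ _ aS.
Qed.

Lemma sa_spec_in_le (J : set R) (T : bop H) : (exists x : H, x != 0) ->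
  sa_spec_in J T -> exists a : R, J a /\ T <=op scal_op a.
Proof.
move=> nz [sT TJ]; have [a [aS aT]] := max_spectrum sT nz.
by exists a; split=> //; have [t Jt /complexI <-] := TJ _ aS.
Qed.

(** A bound in J, uniform in i, survives averaging and keeps the spectrum of the
average inside J. *)
Lemma common_lower_bound (J : set R) n (T : 'I_n -> bop H) (m : R) : J m ->
  (forall i, exists a : R, J a /\ scal_op a <=op T i) ->
  exists u : R, J u /\ forall i, scal_op u <=op T i.
Proof.
move=> Jm h; pose a_ i := sval (cid (h i)).
have aP i : J (a_ i) /\ scal_op (a_ i) <=op T i by rewrite /a_; case: cid.
exists (\big[Num.min/m]_i a_ i); split.
  elim/big_ind: _ => // [x y Jx Jy|i _]; last by case: (aP i).
  by rewrite /Num.min; case: ifP.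
move=> i; apply: (le_op_trans _ (proj2 (aP i))); apply: scal_op_mono.
exact: bigmin_le_cond.
Qed.

Lemma common_upper_bound (J : set R) n (T : 'I_n -> bop H) (M : R) : J M ->
  (forall i, exists a : R, J a /\ T i <=op scal_op a) ->
  exists v : R, J v /\ forall i, T i <=op scal_op v.
Proof.
move=> JM h; pose a_ i := sval (cid (h i)).
have aP i : J (a_ i) /\ T i <=op scal_op (a_ i) by rewrite /a_; case: cid.
exists (\big[Num.max/M]_i a_ i); split.
  elim/big_ind: _ => // [x y Jx Jy|i _]; last by case: (aP i).
  by rewrite /Num.max; case: ifP.
move=> i; apply: (le_op_trans (proj2 (aP i))); apply: scal_op_mono.
exact: le_bigmax_cond.
Qed.

End CommonBounds.

(** * The theorem *)

Theorem corollary2p5 (R : realType) (H : hilbertType R)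
    (J : set R) (f : R -> R) (n : nat) (A B C D : 'I_n -> bop H) (m M : R)
    (Phi : 'I_n -> {linear bop H -> bop H})
    (J_itv : is_interval J)
    (f_cont : {within J, continuous f})
    (f_convex : convex_function J f)
    (A_J : forall i, sa_spec_in J (A i))
    (B_J : forall i, sa_spec_in J (B i))
    (C_J : forall i, sa_spec_in J (C i))
    (D_J : forall i, sa_spec_in J (D i))
    (AD_BC : forall i, A i + D i = B i + C i)
    (m_lt_M : m < M)
    (A_le_m : forall i, A i <=op scal_op m)
    (m_le_B : forall i, scal_op m <=op B i)
    (B_le_M : forall i, B i <=op scal_op M)
    (M_le_D : forall i, scal_op M <=op D i)
    (m_le_C : forall i, scal_op m <=op C i)
    (C_le_M : forall i, C i <=op scal_op M)
    (Phi_pos : forall i, positive_map (Phi i))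
    (Phi_unital : \sum_(i < n) Phi i 1 = 1) :
  let mid : R := (m + M) / 2 in
  let delta : R := f m + f M - 2 * f mid in
  let X1 : bop H := 1 - (1 / (M - m))%:C *:
    (abs_op (\sum_(i < n) Phi i (B i) - scal_op mid)
     + abs_op (\sum_(i < n) Phi i (C i) - scal_op mid)) in
  let X2 : bop H := 1 - (1 / (M - m))%:C *:
    (\sum_(i < n) Phi i (abs_op (B i - scal_op mid))
     + \sum_(i < n) Phi i (abs_op (C i - scal_op mid))) in
  let X3 : bop H := 1 - (1 / (M - m))%:C *:
    (\sum_(i < n) Phi i (abs_op (B i - scal_op mid))
     + abs_op (\sum_(i < n) Phi i (C i) - scal_op mid)) in
  [/\ (cfc f (\sum_(i < n) Phi i (B i)) + cfc f (\sum_(i < n) Phi i (C i))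
         <=op \sum_(i < n) Phi i (cfc f (A i))
              + \sum_(i < n) Phi i (cfc f (D i)) - delta%:C *: X1)
      /\ (\sum_(i < n) Phi i (cfc f (A i))
            + \sum_(i < n) Phi i (cfc f (D i)) - delta%:C *: X1
         <=op \sum_(i < n) Phi i (cfc f (A i))
              + \sum_(i < n) Phi i (cfc f (D i))),
      (\sum_(i < n) Phi i (cfc f (B i)) + \sum_(i < n) Phi i (cfc f (C i))
         <=op cfc f (\sum_(i < n) Phi i (A i))
              + cfc f (\sum_(i < n) Phi i (D i)) - delta%:C *: X2)
      /\ (cfc f (\sum_(i < n) Phi i (A i))
            + cfc f (\sum_(i < n) Phi i (D i)) - delta%:C *: X2
         <=op cfc f (\sum_(i < n) Phi i (A i))
              + cfc f (\sum_(i < n) Phi i (D i)))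
    & (\sum_(i < n) Phi i (cfc f (B i)) + cfc f (\sum_(i < n) Phi i (C i))
         <=op cfc f (\sum_(i < n) Phi i (D i))
              + \sum_(i < n) Phi i (cfc f (A i)) - delta%:C *: X3)
      /\ (cfc f (\sum_(i < n) Phi i (D i))
            + \sum_(i < n) Phi i (cfc f (A i)) - delta%:C *: X3
         <=op cfc f (\sum_(i < n) Phi i (D i))
              + \sum_(i < n) Phi i (cfc f (A i)))].
Proof.
move=> mid delta X1 X2 X3.
(* On the zero space all inequalities are trivial, but spectra are empty. *)
have [nz|/forallNP all0] := pselect (exists x : H, x != 0); last first.
  have triv (S : bop H) : positive_op S.
    by move=> x; have /negP := all0 x; rewrite negbK => /eqP ->; rewrite linear0r.
  by split; split; exact: triv.
have Phi_scal c := average_scal Phi_unital c.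
(* An empty family would give 1 = 0. *)
have [i0 _|I0] := pickP (fun i : 'I_n => true); last first.
  case: nz => x /eqP[]; rewrite -[x]bop1E -Phi_unital big_pred0//.
(* J contains a point below m and one above M, hence both m and M. *)
have [a0 [Ja0 a0A]] := sa_spec_in_ge nz (A_J i0).
have [d0 [Jd0 d0D]] := sa_spec_in_le nz (D_J i0).
have a0m := scal_op_le_inv nz a0A (A_le_m i0).
have Md0 := scal_op_le_inv nz (M_le_D i0) d0D.
have Jm : J m by apply: (J_itv _ _ Ja0 Jd0); apply/andP; split=> //; lra.
have JM : J M by apply: (J_itv _ _ Ja0 Jd0); apply/andP; split=> //; lra.
have [u [Ju uA]] := common_lower_bound Jm (fun i => sa_spec_in_ge nz (A_J i)).
have [v [Jv vD]] := common_upper_bound JM (fun i => sa_spec_in_le nz (D_J i)).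
pose E := average Phi.
have E_ge c (T : 'I_n -> bop H) : (forall i, scal_op c <=op T i) -> scal_op c <=op E T.
  by move=> h; rewrite -Phi_scal; exact: le_average.
have E_le c (T : 'I_n -> bop H) : (forall i, T i <=op scal_op c) -> E T <=op scal_op c.
  by move=> h; rewrite -(Phi_scal c); exact: le_average.
have delta0 : 0 <= delta := sec_gap_ge0 f_convex Jm JM.
have w0 : 0 < M - m by rewrite subr_gt0.
have E_ADBC : E A + E D = E B + E C.
  rewrite -!averageD; congr (average _ _); apply/funext => i; exact: AD_BC.
pose a := slope f m M; pose b := intercept f m M.
(* Each bound comes in two forms: f applied after averaging, or before. *)
have fE_le (T : 'I_n -> bop H) : (forall i, scal_op m <=op T i) ->
    (forall i, T i <=op scal_op M) ->
    cfc f (E T) <=op a%:C *: E T + scal_op (b - delta / 2)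
      + (delta / (M - m))%:C *: abs_op (E T - scal_op mid).
  by move=> mT TM; apply: (cfc_le_secant J_itv f_cont f_convex Jm JM m_lt_M);
    [exact: E_ge|exact: E_le].
have Ef_le (T : 'I_n -> bop H) : (forall i, scal_op m <=op T i) ->
    (forall i, T i <=op scal_op M) ->
    E (fun i => cfc f (T i)) <=op a%:C *: E T + scal_op (b - delta / 2)
      + (delta / (M - m))%:C *: E (fun i => abs_op (T i - scal_op mid)).
  move=> mT TM; rewrite -Phi_scal -!averageZ -!averageD.
  apply: le_average => // i.
  exact: (cfc_le_secant J_itv f_cont f_convex Jm JM m_lt_M).
have absE_le (T : 'I_n -> bop H) : (forall i, scal_op m <=op T i) ->
    (forall i, T i <=op scal_op M) ->
    abs_op (E T - scal_op mid) <=op scal_op ((M - m) / 2).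
  by move=> mT TM; apply: abs_op_le; [exact: E_ge|exact: E_le].
have Eabs_le (T : 'I_n -> bop H) : (forall i, scal_op m <=op T i) ->
    (forall i, T i <=op scal_op M) ->
    E (fun i => abs_op (T i - scal_op mid)) <=op scal_op ((M - m) / 2).
  by move=> mT TM; apply: E_le => i; exact: abs_op_le.
have leEf (T : 'I_n -> bop H) (p q : R) : J p -> J q -> (q <= m) || (M <= p) ->
    (forall i, scal_op p <=op T i) -> (forall i, T i <=op scal_op q) ->
    a%:C *: E T + scal_op b <=op E (fun i => cfc f (T i)).
  move=> Jp Jq pq pT Tq; rewrite -Phi_scal -averageZ -averageD.
  apply: le_average => // i.
  exact: (secant_le_cfc J_itv f_cont f_convex Jm JM m_lt_M Jp Jq pq).
have lefE (T : 'I_n -> bop H) (p q : R) : J p -> J q -> (q <= m) || (M <= p) ->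
    (forall i, scal_op p <=op T i) -> (forall i, T i <=op scal_op q) ->
    a%:C *: E T + scal_op b <=op cfc f (E T).
  move=> Jp Jq pq pT Tq.
  by apply: (secant_le_cfc J_itv f_cont f_convex Jm JM m_lt_M Jp Jq pq);
    [exact: E_ge|exact: E_le].
have um : (m <= m) || (M <= u) by rewrite lexx.
have Mv : (v <= m) || (M <= M) by rewrite lexx orbT.
have EfA := leEf A _ _ Ju Jm um uA A_le_m.
have EfD := leEf D _ _ JM Jv Mv M_le_D vD.
have fEA := lefE A _ _ Ju Jm um uA A_le_m.
have fED := lefE D _ _ JM Jv Mv M_le_D vD.
have fE_B := fE_le B m_le_B B_le_M; have fE_C := fE_le C m_le_C C_le_M.
have Ef_B := Ef_le B m_le_B B_le_M; have Ef_C := Ef_le C m_le_C C_le_M.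
have aE_B := absE_le B m_le_B B_le_M; have aE_C := absE_le C m_le_C C_le_M.
have Ea_B := Eabs_le B m_le_B B_le_M; have Ea_C := Eabs_le C m_le_C C_le_M.
have E_DABC : E D + E A = E B + E C by rewrite addrC.
have part1 := secant_combine delta0 w0 E_ADBC fE_B fE_C aE_B aE_C EfA EfD.
have part2 := secant_combine delta0 w0 E_ADBC Ef_B Ef_C Ea_B Ea_C fEA fED.
have part3 := secant_combine delta0 w0 E_DABC Ef_B fE_C Ea_B aE_C fED EfA.
split; [exact part1|exact part2|exact part3].
Qed.
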